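(* Let $\mathbb{S}$ be the 2-sphere, let $n\geqslant 3$, and let $\big(\mathbb{S},\mathbb{S},n,d,(d_{ij})\big)$ be a branch datum. Suppose that $d$ is a multiple of $2k$ for some integer $k$ with $1<k<d/2$, that all $d_{1j}$ are multiples of $k$, and that all $d_{ij}$ for $i=2,3$ are even. If the branch datum is realizable, then $d_{ij}\leqslant d/k$ for $i=2,3$ and all $j$, and $d_{ij}\leqslant d/(2k)$ for $i=4,\ldots,n$ and all $j$.
   Context: A branched covering is a map $f:\widetilde\Sigma\to\Sigma$ between closed connected surfaces locally modelled on $\mathbb{C}\ni z\mapsto z^k\in\mathbb{C}$, $k\geqslant 1$; the integer $k$ is the local degree at the point of $\widetilde\Sigma$ corresponding to $0$, and if $k>1$ the image point is a branching point. The degree of $f$ is the degree of the genuine covering obtained by removing the branching points and their preimages. A branch datum $\big(\widetilde\Sigma,\Sigma,n,d,(d_{ij})\big)$ consists of closed connected surfaces $\widetilde\Sigma,\Sigma$, integers $n\geqslant 0$, $d\geqslant 2$, and for each $i=1,\ldots,n$ a partition $(d_{ij})_{j=1,\ldots,m_i}$ of $d$ (positive integers with sum $d$). The datum is realizable if there exist a branched covering $f:\widetilde\Sigma\to\Sigma$ of degree $d$ and $n$ distinct points $x_1,\ldots,x_n\in\Sigma$, including all branching points of $f$, such that for each $i$ the local degrees of $f$ at the points of $f^{-1}(x_i)$ form the partition $(d_{ij})_{j=1,\ldots,m_i}$. *)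

(* Defs.v *)
From HB Require Import structures.
From mathcomp Require Import all_boot all_order all_algebra complex.
From mathcomp Require Import all_classical all_reals all_analysis.

Set Implicit Arguments.
Unset Strict Implicit.
Unset Printing Implicit Defensive.

Import Order.TTheory GRing.Theory Num.Theory.
Import numFieldNormedType.Exports.

Local Open Scope classical_set_scope.
Local Open Scope ring_scope.

(* The cast to numFieldType is what gives R[i] the topology of its modulus. *)
Definition Cplane (R : realType) : numFieldType := R[i]%C.

Definition sphere (R : realType) : set 'rV[R]_3 :=
  [set v | \sum_(i < 3) v 0 i ^+ 2 = 1].
Arguments sphere R : clear implicits.

(* As a [set_type], it carries the topology induced from R^3. *)
Definition S2 (R : realType) : topologicalType := set_type (sphere R).

(* [phi] restricts to a homeomorphism from [U] onto the whole plane, with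
   inverse [phi']; the values of [phi] off [U] are irrelevant. *)
Definition homeo_to_plane (R : realType) (X : topologicalType)
    (U : set X) (phi : X -> Cplane R) : Prop :=
  {within U, continuous phi} /\
  exists phi' : Cplane R -> X,
    [/\ continuous phi',
        forall z, U (phi' z),
        forall z, phi (phi' z) = z
      & forall x, U x -> phi' (phi x) = x].

(* In suitable coordinates centred at [p] and at [f p], the map [f] reads
   z |-> z ^ k. *)
Definition local_degree (R : realType) (X Y : topologicalType)
    (f : X -> Y) (p : X) (k : nat) : Prop :=
  (1 <= k)%N /\
  exists (U : set X) (V : set Y) (phi : X -> Cplane R) (psi : Y -> Cplane R),
    [/\ open U /\ U p,
        open V /\ V (f p),
        homeo_to_plane U phi /\ phi p = 0,
        homeo_to_plane V psi /\ psi (f p) = 0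
      & forall x, U x -> V (f x) /\ psi (f x) = phi x ^+ k].

(* Meant for closed connected surfaces [X] and [Y]. Continuity of [f] follows
   from the local models. *)
Definition branched_covering (R : realType) (X Y : topologicalType)
    (f : X -> Y) : Prop :=
  forall p : X, exists k : nat, local_degree R f p k.

Definition branching_point (R : realType) (X Y : topologicalType)
    (f : X -> Y) (y : Y) : Prop :=
  exists (p : X) (k : nat), [/\ f p = y, local_degree R f p k & (1 < k)%N].

(* Number of sheets of the covering over the complement of the branching
   points. *)
Definition covering_degree (R : realType) (X Y : topologicalType)
    (f : X -> Y) (d : nat) : Prop :=
  forall y : Y, ~ branching_point R f y -> (f @^-1` [set y] #= `I_d)%card.

(* The numerical part of a branch datum; [part i] is a partition of [d] listed
   in an arbitrary order. *)
Definition branch_datum (n d : nat) (part : 'I_n -> seq nat) : Prop :=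
  (2 <= d)%N /\
  forall i : 'I_n, all (leq 1) (part i) /\ sumn (part i) = d.

Definition realizable (R : realType) (X Y : topologicalType)
    (n d : nat) (part : 'I_n -> seq nat) : Prop :=
  exists (f : X -> Y) (x : 'I_n -> Y),
    [/\ branched_covering R f,
        covering_degree R f d,
        injective x,
        forall y, branching_point R f y -> exists i, y = x i
      & forall i : 'I_n, exists p : 'I_(size (part i)) -> X,
          [/\ injective p,
              f @^-1` [set x i] = range p
            & forall j, local_degree R f (p j) (nth 0%N (part i) j)]].

(* Main.v *)
(** Let g(z) = (z^k + z^-k)/2, the quotient map of the sphere by the dihedral
    group of order 2k, branched over 1, -1 (index 2) and infinity (index k).
    Place the first three points of the datum at infinity, 1 and -1. Since the
    local degrees of f over them are multiples of k, 2 and 2, f factors as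
    g o h: the function F^2 - 1 has a square root because its local windings
    are even, and then F + sqrt (F^2 - 1) has a k-th root h because its local
    windings are multiples of k. Here F is f in stereographic coordinates, with
    a point over infinity removed from the source, so that every covering
    argument takes place in the punctured plane. Generic fibres of h all have
    the same size m, and 2k m <= d. Near a point of local degree e, a generic
    fibre of f has e points, and h maps them into a neighbourhood on which g is
    injective (so e <= m), or at most two-to-one over 1 and -1 (so e <= 2m). *)
Require Import Defs.
From mathcomp Require Import all_boot all_order all_algebra all_field complex.
From mathcomp Require Import all_classical all_reals all_analysis.
From mathcomp Require Import ring lra.

Set Implicit Arguments.
Unset Strict Implicit.
Unset Printing Implicit Defensive.

Import Order.TTheory GRing.Theory Num.Theory.
Import numFieldNormedType.Exports.

Local Open Scope classical_set_scope.
Local Open Scope ring_scope.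

(** * The complex plane *)

Section Plane.
Variable R : realType.
Local Notation C := (Cplane R).

(** No winding number is ever defined. That k divides the winding at a puncture is expressed by the
    existence of a continuous k-th root on a punctured neighbourhood, and such local roots suffice
    for a global root off a finite set. The topology behind this is that a locally constant function
    on the plane minus a finite set is constant, which reduces to the connectedness of the line and
    to exp mapping the plane onto the nonzero numbers. The function u = F + sqrt (F^2 - 1) has no
    zeros, since its inverse is F - sqrt (F^2 - 1), so only the poles of F are punctures for it.
    There u behaves like 2F or 1/(2F), whose windings are divisible by k along with those of F. The
    lift h is built only off the fibre over infinity, which is enough because the bounds concern
    points over other values. The inequality 2km <= d holds because a generic value has 2k preimages
    under g, each with m preimages under h, all inside one fibre of f of size d. The factor 2 lost
    over 1 and -1 comes from the exchange of z^k and z^-k, which coincide there. *)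

Definition re (z : C) : R := complex.Re z.
Definition im (z : C) : R := complex.Im z.
Definition mk (x y : R) : C := Complex x y.

Lemma mkE (z : C) : mk (re z) (im z) = z. Proof. by case: z. Qed.
Lemma re_mk x y : re (mk x y) = x. Proof. by []. Qed.
Lemma im_mk x y : im (mk x y) = y. Proof. by []. Qed.
Lemma ceqP (z w : C) : re z = re w -> im z = im w -> z = w.
Proof. by case: z w => a b [c d] /= -> ->. Qed.
Lemma reD (z w : C) : re (z + w) = re z + re w. Proof. by case: z w => a b [c d]. Qed.
Lemma imD (z w : C) : im (z + w) = im z + im w. Proof. by case: z w => a b [c d]. Qed.
Lemma reN (z : C) : re (- z) = - re z. Proof. by case: z. Qed.
Lemma imN (z : C) : im (- z) = - im z. Proof. by case: z. Qed.
Lemma reM (z w : C) : re (z * w) = re z * re w - im z * im w. Proof. by case: z w => a b [c d]. Qed.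
Lemma imM (z w : C) : im (z * w) = re z * im w + im z * re w. Proof. by case: z w => a b [c d]. Qed.
Lemma re0 : re 0 = 0. Proof. by []. Qed.
Lemma im0 : im 0 = 0. Proof. by []. Qed.
Lemma re1 : re 1 = 1. Proof. by []. Qed.
Lemma im1 : im 1 = 0. Proof. by []. Qed.
Definition cE := (reD, imD, reN, imN, reM, imM, re0, im0, re1, im1, re_mk, im_mk).

Lemma norm_mk (z : C) : `|z| = mk (Num.sqrt (re z ^+ 2 + im z ^+ 2)) 0.
Proof. exact: normc_def. Qed.

Lemma re_le_norm (z : C) : mk `|re z| 0 <= `|z|.
Proof. exact: normc_ge_Re. Qed.

Lemma ltc_mk (x y : R) : (mk x 0 < mk y 0) = (x < y).
Proof. exact: ltcR. Qed.
Lemma lec_mk (x y : R) : (mk x 0 <= mk y 0) = (x <= y).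
Proof. exact: lecR. Qed.


Lemma im_le_norm (z : C) : mk `|im z| 0 <= `|z|.
Proof.
rewrite norm_mk lec_mk -sqrtr_sqr; apply: ler_wsqrtr.
by rewrite lerDr sqr_ge0.
Qed.

Lemma re_cont : continuous re.
Proof.
move=> z; apply: (@cvgrPdist_lt _ _ _ (nbhs z) _ re (re z)).2 => e e0.
have e0' : (0 : C) < mk e 0 by rewrite (ltc_mk 0).
apply: filterS (nbhsx_ballx z _ e0') => w zw.
by rewrite -ltc_mk -reN -reD; apply: le_lt_trans (re_le_norm _) zw.
Qed.

Lemma im_cont : continuous im.
Proof.
move=> z; apply: (@cvgrPdist_lt _ _ _ (nbhs z) _ im (im z)).2 => e e0.
have e0' : (0 : C) < mk e 0 by rewrite (ltc_mk 0).
apply: filterS (nbhsx_ballx z _ e0') => w zw.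
by rewrite -ltc_mk -imN -imD; apply: le_lt_trans (im_le_norm _) zw.
Qed.

Lemma rc_cont : continuous (fun x : R => mk x 0).
Proof.
move=> x; apply/cvgrPdist_lt => e; rewrite -(mkE e) ltcE /= => /andP[/eqP -> e0].
apply: filterS (nbhsx_ballx x _ e0) => y xy.
by rewrite norm_mk !cE oppr0 addr0 expr0n addr0 sqrtr_sqr ltc_mk.
Qed.

Lemma mkDE x y : mk x y = mk x 0 + mk 0 1 * mk y 0.
Proof. by apply: ceqP; rewrite !cE; ring. Qed.

Lemma mk_cvg (T : Type) (F : set_system T) {FF : Filter F} (f g : T -> R) (a b : R) :
  f @ F --> a -> g @ F --> b -> (fun t => mk (f t) (g t)) @ F --> mk a b.
Proof.
move=> fa gb; rewrite mkDE.
have -> : (fun t => mk (f t) (g t)) = (fun t => mk (f t) 0 + mk 0 1 * mk (g t) 0).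
  by apply/funext => t; rewrite mkDE.
have h1 : (fun t => mk (f t) 0) @ F --> mk a 0.
  by move=> A /rc_cont /fa.
have h2 : (fun t => mk (g t) 0) @ F --> mk b 0.
  by move=> A /rc_cont /gb.
exact: (cvgD h1 (cvgM (cvg_cst _) h2)).
Qed.

Lemma closed_root (n : nat) (a : C) : (0 < n)%N -> exists b : C, b ^+ n = a.
Proof.
move=> n0; have [b hb] := @solve_monicpoly R[i]%C n (fun i => if i is 0 then a else 0) n0.
exists b; rewrite [LHS]hb; case: n n0 hb => // n _ _.
by rewrite big_ord_recl /= mulr1 big1 ?addr0 // => i _; rewrite mul0r.
Qed.

(** [X^n - 1] is separable and splits, so there are n distinct roots of unity; multiplying them by
    one root of [a] gives all roots of [a]. *)
Lemma nth_roots (n : nat) (a : C) : (0 < n)%N -> a != 0 ->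
  exists s : seq C, [/\ uniq s, size s = n & forall z, (z \in s) = (z ^+ n == a)].
Proof.
move=> n0 a0; have [b ba] := closed_root a n0.
have b0 : b != 0 by apply: contra_neq a0 => b0; rewrite -ba b0 expr0n gtn_eqF.
pose p : {poly R[i]%C} := 'X^n - 1.
have [r Dp] := closed_field_poly_normal p.
rewrite (monicP _) ?monicXnsubC // scale1r in Dp.
have ur : uniq r.
  by rewrite -separable_prod_XsubC -Dp separable_Xn_sub_1 // pnatr_eq0 -lt0n.
exists [seq b * z | z <- (r : seq C)]; split.
- by rewrite map_inj_uniq //; apply: mulfI.
- by rewrite size_map; apply: succn_inj; rewrite -(size_prod_XsubC r id) -Dp size_XnsubC.
- move=> z; rewrite -[z in LHS](mulVKf b0) mem_map; last exact: mulfI.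
  rewrite -[LHS]root_prod_XsubC -Dp rootE !hornerE subr_eq0.
  rewrite -[RHS](inj_eq (mulfI (invr_neq0 a0))) mulVf //.
  by rewrite exprMn exprVn ba.
Qed.
End Plane.

(** * Pointwise continuity of algebraic expressions *)

Section Continuity.
Variables (C : numFieldType) (X : topologicalType).
Implicit Types (f g : X -> C) (x : X).

Lemma ctsM f g x : {for x, continuous f} -> {for x, continuous g} ->
  {for x, continuous (fun y => f y * g y)}.
Proof. by move=> cf cg; exact: (cvgM cf cg). Qed.

Lemma ctsD f g x : {for x, continuous f} -> {for x, continuous g} ->
  {for x, continuous (fun y => f y + g y)}.
Proof. by move=> cf cg; exact: (cvgD cf cg). Qed.

Lemma ctsN f x : {for x, continuous f} -> {for x, continuous (fun y => - f y)}.
Proof. by move=> cf; exact: (cvgN cf). Qed.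

Lemma ctsB f g x : {for x, continuous f} -> {for x, continuous g} ->
  {for x, continuous (fun y => f y - g y)}.
Proof. by move=> cf cg; exact: (cvgB cf cg). Qed.

Lemma ctsV f x : f x != 0 -> {for x, continuous f} ->
  {for x, continuous (fun y => (f y)^-1)}.
Proof. by move=> f0 cf; exact: (cvgV f0 cf). Qed.

Lemma cts_cst (a : C) x : {for x, continuous (fun _ : X => a)}.
Proof. exact: cvg_cst. Qed.

Lemma ctsX f n x : {for x, continuous f} -> {for x, continuous (fun y => f y ^+ n)}.
Proof.
move=> cf; elim: n => [|n IH].
  exact: (@cts_cst 1).
have -> : (fun y => f y ^+ n.+1) = (fun y => f y * f y ^+ n).
  by apply/funext => y; rewrite exprS.
exact: ctsM.
Qed.

Lemma cts_prod n (f : nat -> X -> C) x : (forall j, (j < n)%N -> {for x, continuous (f j)}) ->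
  {for x, continuous (fun y => \prod_(j < n) f j y)}.
Proof.
elim: n => [|n IH] cf.
  have -> : (fun y => \prod_(j < 0) f j y) = (fun=> 1) by apply/funext => y; rewrite big_ord0.
  exact: cts_cst.
have -> : (fun y => \prod_(j < n.+1) f j y) = (fun y => (\prod_(j < n) f j y) * f n y).
  by apply/funext => y; rewrite big_ord_recr.
by apply: ctsM; [apply: IH => j jn; apply: cf; rewrite ltnW | exact: cf].
Qed.

Lemma cts_near (Y : topologicalType) (f g : X -> Y) x : (\forall y \near x, f y = g y) ->
  {for x, continuous f} -> {for x, continuous g}.
Proof.
move=> fg cf; rewrite /prop_for /continuous_at -(nbhs_singleton fg).
move=> A /cf; exact: (near_eq_cvg fg).
Qed.

Lemma cts_comp (Y Z : topologicalType) (f : X -> Y) (g : Y -> Z) x :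
  {for x, continuous f} -> {for f x, continuous g} ->
  {for x, continuous (fun y => g (f y))}.
Proof. exact: continuous_comp. Qed.

Lemma near_pull (Y : topologicalType) (f : X -> Y) (P : set Y) x :
  {for x, continuous f} -> (\forall z \near f x, P z) -> \forall y \near x, P (f y).
Proof. by move=> cf; exact: cf. Qed.

Lemma cts_nz f x : {for x, continuous f} -> f x != 0 -> \forall y \near x, f y != 0.
Proof. by move=> cf f0; exact: (cvgr_neq0 (f x) cf f0). Qed.
End Continuity.

(** * Connectedness of the line and the plane; exponential and logarithm *)

Section Plane.
Variable R : realType.
Local Notation C := (Cplane R).

Lemma cts_id (X : topologicalType) (x : X) : {for x, continuous (fun y : X => y)}.
Proof. exact: cvg_id. Qed.

Lemma cts_mk (X : topologicalType) (f g : X -> R) x :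
  {for x, continuous f} -> {for x, continuous g} ->
  {for x, continuous (fun y => mk (f y) (g y) : C)}.
Proof. by move=> cf cg; exact: (mk_cvg cf cg). Qed.

Lemma hausdorff_near (X : topologicalType) (x y : X) : hausdorff_space X -> x != y ->
  exists A B : set X, [/\ nbhs x A, nbhs y B & forall z, A z -> B z -> False].
Proof.
rewrite open_hausdorff => h /h[[A B] /= [xA yB] [oA oB /eqP AB]].
exists A, B; split.
- by apply: open_nbhs_nbhs; split=> //; exact: set_mem.
- by apply: open_nbhs_nbhs; split=> //; exact: set_mem.
- by move=> z Az Bz; have : (A `&` B) z by []; rewrite AB.
Qed.

Lemma near_notin_hausdorff (X : topologicalType) (s : seq X) (p : X) :
  hausdorff_space X -> \forall z \near p^', z \notin s.
Proof.
move=> hX; elim: s => [|a s IH]; first exact: filterE.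
have near_neq : \forall z \near p^', z != a.
  have [->|pa] := eqVneq p a; first exact: nbhs_dnbhs_neq.
  have [A [B [pA aB AB]]] := hausdorff_near hX pa.
  apply: nbhs_dnbhs; apply: filterS pA => z Az; apply/eqP => za.
  by apply: (AB z) => //; rewrite za; exact: nbhs_singleton.
by near=> z; rewrite inE negb_or; apply/andP; split; near: z.
Unshelve. all: by end_near. Qed.

Lemma near_notin (s : seq C) (p : C) : \forall z \near p^', z \notin s.
Proof. exact: (near_notin_hausdorff _ _ (@norm_hausdorff _ C)). Qed.

Lemma near_dnbhs (X : topologicalType) (P : set X) (p : X) :
  (\forall z \near p^', P z) -> \forall z \near p, z != p -> P z.
Proof. by []. Qed.

Lemma dnbhs_near (X : topologicalType) (P : set X) (p : X) :
  (\forall z \near p, z != p -> P z) -> \forall z \near p^', P z.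
Proof. by []. Qed.

Lemma near_pull_dnbhs (X Y : topologicalType) (f : X -> Y) (P : set Y) (x : X) :
  {for x, continuous f} -> (forall y, f y = f x -> y = x) ->
  (\forall z \near (f x)^', P z) -> \forall y \near x^', P (f y).
Proof. by move=> cf fx; exact: (continuous_injective_withinNx cf fx). Qed.

Lemma near_notin_out (s : seq C) (p : C) : p \notin s -> \forall z \near p, z \notin s.
Proof.
move=> ps; have := near_dnbhs (near_notin s p); apply: filterS => z h.
by have [->//|/h] := eqVneq z p.
Qed.

Lemma near_unity k (p : C) : (0 < k)%N -> \forall v \near p, v ^+ k = 1 -> v = p.
Proof.
move=> k0; have [s [us _ hs]] := nth_roots k0 (oner_neq0 C).
have h : \forall v \near p, v \notin rem p s.
  by apply: near_notin_out; rewrite mem_rem_uniq // !inE eqxx.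
apply: filterS h => v + /eqP; rewrite -hs mem_rem_uniq // inE => + vs.
by rewrite vs andbT negbK => /eqP.
Qed.

(** Roots of unity form a finite, hence discrete, set. Uniqueness of roots rests on this: the
    quotient of two continuous k-th roots of one nonvanishing function is locally constant. *)
Lemma unity_loc_const (X : topologicalType) (g : X -> C) k x : (0 < k)%N ->
  {for x, continuous g} -> (\forall y \near x, g y ^+ k = 1) ->
  \forall y \near x, g y = g x.
Proof.
move=> k0 cg g1; apply: filterS2 (near_pull cg (near_unity (g x) k0)) g1 => y.
exact.
Qed.

(** Every union of level sets is open, so a level set is open and closed in a connected space; the
    target can be a bare type. *)
Lemma loc_const_R (T : Type) (g : R -> T) :
  (forall x, \forall y \near x, g y = g x) -> forall x y, g x = g y.
Proof.
move=> lc x y.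
have cR : connected [set: R] by apply/connected_intervalP.
have oA (P : T -> Prop) : open [set z | P (g z)].
  rewrite openE => z /= Pz; have := lc z.
  by apply: filterS => w /= ->.
have /seteqP[_ /(_ y I) //] : [set z | g x = g z] = [set: R].
  apply: cR; first by exists x.
    exists [set z | g x = g z]; last by rewrite setTI.
    exact: (oA (fun t => g x = t)).
  exists [set z | g x = g z]; last by rewrite setTI.
  rewrite -openC; exact: (oA (fun t => ~ (g x = t))).
Qed.

Definition rc (t : R) : C := mk t 0.

Lemma cts_rc (X : topologicalType) (f : X -> R) x :
  {for x, continuous f} -> {for x, continuous (fun y => rc (f y))}.
Proof. by move=> cf; apply: cts_mk => //; exact: cvg_cst. Qed.

Lemma cts_re (X : topologicalType) (f : X -> C) x :
  {for x, continuous f} -> {for x, continuous (fun y => re (f y))}.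
Proof. by move=> cf; apply: (cts_comp cf); exact: re_cont. Qed.

Lemma cts_im (X : topologicalType) (f : X -> C) x :
  {for x, continuous f} -> {for x, continuous (fun y => im (f y))}.
Proof. by move=> cf; apply: (cts_comp cf); exact: im_cont. Qed.

Lemma loc_const_C (T : Type) (g : C -> T) :
  (forall x, \forall y \near x, g y = g x) -> forall x y, g x = g y.
Proof.
move=> lc x y.
pose p (t : R) := x + rc t * (y - x).
have cp t : {for t, continuous p}.
  by apply: ctsD; [exact: cts_cst|apply: ctsM; [apply: cts_rc; exact: cts_id|exact: cts_cst]].
have := @loc_const_R _ (g \o p) _ 0 1; rewrite /= /p.
have -> : rc 0 = 0 by [].
have -> : rc 1 = 1 by [].
rewrite mul0r addr0 mul1r [x + _]addrC subrK; apply.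
by move=> t; exact: (near_pull (cp t) (lc (p t))).
Qed.

Definition cexp (z : C) : C := mk (expR (re z) * cos (im z)) (expR (re z) * sin (im z)).

Lemma cexpD z w : cexp (z + w) = cexp z * cexp w.
Proof.
by apply: ceqP; rewrite /cexp !cE expRD ?cosD ?sinD; ring.
Qed.

Lemma cexp0 : cexp 0 = 1.
Proof. by apply: ceqP; rewrite /cexp !cE expR0 ?cos0 ?sin0 ?mulr1 ?mulr0. Qed.

Lemma cexp_neq0 z : cexp z != 0.
Proof.
apply/eqP => z0; have := cexpD z (- z).
by rewrite subrr cexp0 z0 mul0r => /eqP; rewrite oner_eq0.
Qed.

Lemma cexpMn z n : cexp (z *+ n) = cexp z ^+ n.
Proof.
by elim: n => [|n IH]; rewrite ?mulr0n ?cexp0 ?expr0 // mulrS cexpD IH exprS.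
Qed.

Lemma cexp_cont : continuous cexp.
Proof.
move=> z.
have cr : {for z, continuous (fun y => expR (re y))}.
  by apply: (cts_comp (@re_cont R z)); exact: continuous_expR.
apply: (@cts_mk _ (fun y => expR (re y) * cos (im y)) (fun y => expR (re y) * sin (im y))).
  apply: (cvgM cr); apply: (cts_comp (@im_cont R z)); exact: continuous_cos.
apply: (cvgM cr); apply: (cts_comp (@im_cont R z)); exact: continuous_sin.
Qed.

(** The principal branch on the right half-plane, the region where [atan (im z / re z)] is the
    argument. *)
Definition clog (z : C) : C :=
  mk (ln (re z ^+ 2 + im z ^+ 2) / 2) (atan (im z / re z)).

Lemma clogK z : 0 < re z -> cexp (clog z) = z.
Proof.
move=> x0; have xn0 := lt0r_neq0 x0.
have n0 : 0 < re z ^+ 2 + im z ^+ 2 by rewrite ltr_wpDr ?sqr_ge0 // exprn_gt0.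
have e : expR (ln (re z ^+ 2 + im z ^+ 2) / 2) * cos (atan (im z / re z)) = re z.
  have q0 : 0 < 1 + (im z / re z) ^+ 2 by rewrite ltr_wpDr ?sqr_ge0.
  have -> : re z ^+ 2 + im z ^+ 2 = re z ^+ 2 * (1 + (im z / re z) ^+ 2) by field.
  apply: (@pexpIrn _ 2) => //; rewrite ?nnegrE ?mulr_ge0 ?expR_ge0 ?ltW //.
    by rewrite cos_atan invr_gt0 sqrtr_gt0.
  rewrite exprMn -expRM_natl -mulr_natl mulrC cos_atan exprVn sqr_sqrtr ?ltW //.
  rewrite mulrCA divff // mulr1 lnK ?posrE ?mulr_gt0 ?exprn_gt0 //.
  by rewrite mulrCA mulVf ?mulr1 ?lt0r_neq0.
apply: ceqP; rewrite /cexp /clog !cE //.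
have : sin (atan (im z / re z)) = tan (atan (im z / re z)) * cos (atan (im z / re z)).
  by rewrite /tan mulfVK // cos_atan invr_neq0 // sqrtr_eq0 -ltNge ltr_wpDr ?sqr_ge0.
by move=> ->; rewrite atanK mulrCA e mulfVK.
Qed.

Lemma clog_cont z : 0 < re z -> {for z, continuous clog}.
Proof.
move=> x0.
apply: (@cts_mk _ (fun z => ln (re z ^+ 2 + im z ^+ 2) / 2) (fun z => atan (im z / re z))).
  apply: ctsM; last exact: cts_cst.
  apply: (@cts_comp _ _ _ (fun z : C => re z ^+ 2 + im z ^+ 2) (@ln R)).
    by apply: ctsD; apply: ctsX; [exact: re_cont | exact: im_cont].
  by apply: continuous_ln; rewrite ltr_wpDr ?sqr_ge0 // exprn_gt0.
apply: (@cts_comp _ _ _ (fun z : C => im z / re z) atan).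
  apply: ctsM; first exact: im_cont.
  by apply: ctsV; [exact: lt0r_neq0|exact: re_cont].
exact: continuous_atan.
Qed.

Lemma clog1 : clog 1 = 0.
Proof.
apply: ceqP; rewrite /clog !cE ?mul0r ?atan0 //.
by rewrite expr1n expr0n addr0 ln1 mul0r.
Qed.
End Plane.

(** * Connectedness of the plane minus finitely many points *)

Section Plane.
Variable R : realType.
Local Notation C := (Cplane R).
Implicit Types z w p : C.

(** A turn by a multiple of a right angle brings any nonzero number into the half-plane where
    [clogK] applies, and a fourth power does not see the turn. *)
Lemma re_neq0_sign (v : C) : v != 0 -> exists2 c : C, c ^+ 4 = 1 & 0 < re (c * v).
Proof.
move=> v0.
have i4 : (mk 0 1 : C) ^+ 4 = 1 by rewrite !exprS expr0; apply: ceqP; rewrite !cE; ring.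
have Ni4 : (mk 0 (-1) : C) ^+ 4 = 1 by rewrite !exprS expr0; apply: ceqP; rewrite !cE; ring.
case: (ltrgtP (re v) 0) => [vlt|vgt|ve].
- exists (-1); last by rewrite mulN1r reN oppr_gt0.
  by rewrite !exprS expr0; ring.
- by exists 1; rewrite ?expr1n // mul1r.
- case: (ltrgtP (im v) 0) => [vlt|vgt|ve'].
  + by exists (mk 0 1); rewrite // !cE mul0r mul1r sub0r oppr_gt0.
  + by exists (mk 0 (-1)); rewrite // !cE mul0r mulN1r sub0r opprK.
  + by case/eqP: v0; apply: ceqP.
Qed.

Lemma cexp_surj z : z != 0 -> exists s, cexp s = z.
Proof.
move=> z0; have [v vz] := @closed_root _ 4 z isT.
have v0 : v != 0 by apply: contra_neq z0 => v0; rewrite -vz v0 expr0n.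
have [c c4 cv] := re_neq0_sign v0.
by exists (clog (c * v) *+ 4); rewrite cexpMn clogK // exprMn c4 mul1r.
Qed.

Definition kroot (k : nat) z : C := cexp (k%:R^-1 * clog z).

Lemma krootK k z : (0 < k)%N -> 0 < re z -> kroot k z ^+ k = z.
Proof.
move=> k0 z0; rewrite -cexpMn -(mulr_natl (_ * _)) mulrA divff ?mul1r ?clogK //.
by rewrite pnatr_eq0 -lt0n.
Qed.

Lemma kroot_cont k z : 0 < re z -> {for z, continuous (kroot k)}.
Proof.
move=> z0; apply: (@cts_comp _ _ _ (fun z => k%:R^-1 * clog z)).
  by apply: ctsM; [exact: cts_cst | exact: clog_cont].
exact: cexp_cont.
Qed.

Lemma kroot1 k : kroot k 1 = 1.
Proof. by rewrite /kroot clog1 mulr0 cexp0. Qed.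

(** The punctured plane is the continuous image of the plane under [cexp], and so inherits its
    connectedness. *)
Lemma loc_const_Cstar (T : Type) (g : C -> T) :
  (forall z, z != 0 -> \forall w \near z, g w = g z) ->
  forall z w, z != 0 -> w != 0 -> g z = g w.
Proof.
move=> lc z w /cexp_surj[s <-] /cexp_surj[t <-].
apply: (@loc_const_C R _ (g \o (@cexp R))) => x.
exact: (near_pull (@cexp_cont R x) (lc _ (cexp_neq0 _))).
Qed.

(** The l1 norm, with values in the reals: [|z|] is itself a complex number, which fits badly with
    real radii and with compact squares in R x R. *)
Definition norm1 z : R := `|re z| + `|im z|.

Lemma norm1_cont : continuous norm1.
Proof.
move=> z; apply: (@ctsD _ _ (fun z => `|re z|) (fun z => `|im z|)).
  by apply: (cts_comp (@re_cont R z)); exact: norm_continuous.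
by apply: (cts_comp (@im_cont R z)); exact: norm_continuous.
Qed.

Lemma norm_le_norm1 z : `|z| <= rc (norm1 z).
Proof.
rewrite norm_mk lec_mk /norm1 -(ger0_norm (addr_ge0 (normr_ge0 (re z)) (normr_ge0 (im z)))).
rewrite -sqrtr_sqr; apply: ler_wsqrtr.
rewrite sqrrD !real_normK ?num_real // addrAC lerDl.
by rewrite mulrn_wge0 // mulr_ge0.
Qed.

Lemma norm1_rc z t : 0 <= t -> norm1 (z * rc t) = norm1 z * t.
Proof.
by move=> t0; rewrite /norm1 !cE !mulr0 subr0 add0r !normrM (ger0_norm t0) mulrDl.
Qed.

Lemma norm10 : norm1 0 = 0. Proof. by rewrite /norm1 !cE normr0 addr0. Qed.

Lemma nbhs_norm1 p (Q : set C) : (\forall z \near p, Q z) ->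
  exists2 d : R, 0 < d & forall z, norm1 (z - p) <= d -> Q z.
Proof.
move=> /nbhs_ballP[/= e e0 eQ].
have [d d0 de] : exists2 d : R, 0 < d & rc d < e.
  move: e0; rewrite -(mkE e) ltcE /= => /andP[/eqP -> e0].
  exists (re e / 2); first by rewrite divr_gt0.
  by rewrite ltc_mk ltr_pdivrMr // ltr_pMr // ltr1n.
exists d => // z zd; apply: eQ.
rewrite /ball /= -opprB normrN; apply: le_lt_trans (norm_le_norm1 _) _.
by apply: le_lt_trans _ de; rewrite lec_mk.
Qed.

Lemma near_norm1 p d : 0 < d -> \forall z \near p, norm1 (z - p) < d.
Proof.
move=> d0; have cp : {for p, continuous (fun z => norm1 (z - p))}.
  apply: (@cts_comp _ _ _ (fun z => z - p)); last exact: norm1_cont.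
  by apply: ctsB; [exact: cts_id | exact: cts_cst].
have := @cvgr_lt _ _ _ _ _ _ cp d.
by rewrite subrr norm10; apply.
Qed.

(** The radial retraction onto the [norm1]-ball of radius [d]. The maximum keeps the denominator
    positive and replaces a case distinction at the boundary. *)
Definition radial (d : R) z : C := z * rc (d / Num.max (norm1 z) d).

Section Radial.
Variable d : R.
Hypothesis d0 : 0 < d.

Let m0 z : 0 < Num.max (norm1 z) d. Proof. by rewrite lt_max d0 orbT. Qed.

Let f0 z : 0 < d / Num.max (norm1 z) d. Proof. exact: divr_gt0. Qed.

Lemma radial_cont : continuous (radial d).
Proof.
have cc z : {for z, continuous (fun z => z * rc (d / Num.max (norm1 z) d))}.
  apply: ctsM; first exact: cts_id.
  apply: cts_rc; apply: ctsM; first exact: cts_cst.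
  apply: ctsV; first exact: lt0r_neq0.
  by apply: continuous_max; [exact: norm1_cont | exact: cts_cst].
exact: cc.
Qed.

Lemma radial_neq0 z : z != 0 -> radial d z != 0.
Proof.
move=> z0; rewrite mulf_neq0 //; have := f0 z; apply: contraTneq.
by move=> /(congr1 (@re R)); rewrite re_mk => ->; rewrite ltxx.
Qed.

Lemma norm1_radial z : norm1 (radial d z) <= d.
Proof.
rewrite norm1_rc ?(ltW (f0 z)) // mulrCA ger_pMr // ler_pdivrMr // mul1r.
by rewrite le_max lexx.
Qed.

Lemma radial_id z : norm1 z <= d -> radial d z = z.
Proof.
move=> zd; rewrite /radial max_r // divff ?lt0r_neq0 //.
have -> : rc 1 = 1 by [].
by rewrite mulr1.
Qed.

Lemma radial0 : radial d 0 = 0. Proof. by rewrite /radial mul0r. Qed.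
End Radial.

(** A retraction of the plane onto a small ball around [p] under which only [p] goes to [p].
    Composition with it extends a function known near [p] to the whole punctured plane without new
    singularities. *)
Lemma clamp p (Q : set C) : (\forall z \near p^', Q z) ->
  exists c : C -> C, [/\ continuous c,
    forall z, z != p -> c z != p /\ Q (c z) & \forall z \near p, c z = z].
Proof.
move=> /near_dnbhs/nbhs_norm1[d d0 eQ].
have cc z : {for z, continuous (fun z => p + radial d (z - p))}.
  apply: ctsD; first exact: cts_cst.
  apply: (@cts_comp _ _ _ (fun z => z - p)); last exact: radial_cont.
  by apply: ctsB; [exact: cts_id | exact: cts_cst].
exists (fun z => p + radial d (z - p)); split=> //.
- move=> z zp; have np : p + radial d (z - p) != p.
    by rewrite -subr_eq0 [p + _]addrC addrK radial_neq0 ?subr_eq0.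
  by split=> //; apply: eQ np; rewrite [p + _]addrC addrK norm1_radial.
- apply: filterS (near_norm1 p d0) => z zd.
  by rewrite radial_id ?(ltW zd) // addrC subrK.
Qed.

Lemma loc_const_punctured (T : Type) (g : C -> T) p :
  (\forall z \near p^', \forall w \near z, g w = g z) ->
  exists a, \forall z \near p^', g z = a.
Proof.
move=> /clamp[c [cc cp cid]].
exists (g (c (p + 1))).
apply: dnbhs_near; apply: filterS cid => z cz zp.
rewrite -[in LHS]cz; have := @loc_const_Cstar _ (fun z => g (c (p + z))) _ (z - p) 1.
rewrite addrCA subrr addr0; apply; rewrite ?subr_eq0 ?oner_eq0 // => t t0.
apply: (@near_pull _ _ (fun t => c (p + t)) (fun w => g w = g (c (p + t)))).
  apply: (@cts_comp _ _ _ (fun t => p + t)); last exact: cc.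
  by apply: ctsD; [exact: cts_cst | exact: cts_id].
by have [|_] := cp (p + t) => //; rewrite -subr_eq0 addrC addKr.
Qed.

(** The punctures are filled one at a time: on a punctured neighbourhood of [p] the function has a
    single value, which is then assigned to [p] as well. *)
Lemma loc_const_off (T : Type) (S : seq C) (g : C -> T) :
  (forall z, z \notin S -> \forall w \near z, g w = g z) ->
  forall z w, z \notin S -> w \notin S -> g z = g w.
Proof.
elim: S g => [|p S IH] g lc z w.
  by move=> _ _; apply: loc_const_C => x; exact: lc.
have [pS|pS] := boolP (p \in S).
  have e x : (x \notin p :: S) = (x \notin S).
    by rewrite inE; have [->|] := eqVneq x p; rewrite ?pS.
  by rewrite !e; apply: IH => x xS; apply: lc; rewrite e.
rewrite !inE !negb_or => /andP[zp zS] /andP[wp wS].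
have [a ha] : exists a, \forall z \near p^', g z = a.
  apply: loc_const_punctured; apply: filterS (near_notin (p :: S) p) => x.
  exact: lc.
have := IH (fun z => if z == p then a else g z) _ z w zS wS.
rewrite (negbTE zp) (negbTE wp); apply=> x xS.
have [->|xp] := eqVneq x p.
  by apply: filterS (near_dnbhs ha) => y; case: eqVneq => // _; apply.
have xpS : x \notin p :: S by rewrite inE negb_or xp.
have hp : \forall y \near x, y \notin [:: p].
  by apply: near_notin_out; rewrite inE.
by apply: filterS2 hp (lc x xpS) => y; rewrite inE => /negbTE ->.
Qed.
End Plane.

(** * Roots of functions on the plane *)

Section Roots.
Variable R : realType.
Local Notation C := (Cplane R).
Implicit Types z w p : C.

(** Both arguments are below pi/4 in absolute value, so their difference is below pi/2. *)
Lemma re_div_sector (a b : C) : `|im a| < re a -> `|im b| < re b -> 0 < re (a / b).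
Proof.
move=> ha hb.
have ra : 0 < re a by apply: le_lt_trans ha.
have rb : 0 < re b by apply: le_lt_trans hb.
have b0 : b != 0 by apply: contraTneq rb => ->; rewrite re0 ltxx.
have n0 : 0 < re b ^+ 2 + im b ^+ 2 by rewrite ltr_wpDr ?sqr_ge0 // exprn_gt0.
have -> : a / b = a * mk (re b / (re b ^+ 2 + im b ^+ 2)) (- (im b / (re b ^+ 2 + im b ^+ 2))).
  apply: (mulIf b0); rewrite mulfVK // -mulrA -[LHS]mulr1; congr (_ * _).
  by apply: ceqP; rewrite !cE; field; rewrite lt0r_neq0.
rewrite !cE mulrN opprK !mulrA -mulrDl divr_gt0 //.
apply: (@le_lt_trans _ _ (`|im a| * `|im b| + im a * im b)).
  by rewrite -normrM -lerBlDr sub0r -normrN ler_norm.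
by rewrite ltrD2r ltr_pM.
Qed.

Lemma norm1D z w : norm1 (z + w) <= norm1 z + norm1 w.
Proof. by rewrite /norm1 !cE addrACA lerD // ler_normD. Qed.

(** Uniform continuity in multiplicative form, from compactness of a square: over short distances
    the ratios stay in the half-plane where principal roots exist. *)
Lemma uniform_ratio (F : C -> C) : continuous F -> (forall z, F z != 0) ->
  forall n : R, exists2 d : R, 0 < d &
    forall z w, norm1 z <= n -> norm1 (w - z) <= d -> 0 < re (F w / F z).
Proof.
move=> cF F0 n.
pose K := `[- n, n]%classic `*` `[- n, n]%classic : set (R * R).
have cK : compact K by apply: compact_setX; exact: segment_compact.
pose P (d : R) (x : R * R) :=
  forall w, norm1 (w - mk x.1 x.2) <= d -> 0 < re (F w / F (mk x.1 x.2)).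
have loc (x : R * R) : K x -> \forall x' \near x & i \near 0^'+, P i x'.
  move=> _.
  pose z0 : C := mk x.1 x.2.
  have cz : {for z0, continuous (fun z => F z / F z0)}.
    by apply: ctsM; [exact: cF | exact: cts_cst].
  (* A sector of half-angle pi/4 is needed here, because [F w / F z] will be a quotient of two
     ratios based at [z0]. *)
  have : \forall z \near z0, `|im (F z / F z0)| < re (F z / F z0).
    have ch : {for z0, continuous (fun z => re (F z / F z0) - `|im (F z / F z0)|)}.
      apply: ctsB; first exact: cts_re.
      by apply: (cts_comp (cts_im cz)); exact: norm_continuous.
    have := @cvgr_gt _ _ _ _ _ _ ch 0.
    rewrite divff // re1 im1 normr0 subr0 => /(_ _ ltr01).
    by apply: filterS => z; rewrite subr_gt0.
  move=> /nbhs_norm1[d d0 hd].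
  have d20 : 0 < d / 2 by rewrite divr_gt0.
  exists ([set x' : R * R | norm1 (mk x'.1 x'.2 - z0) < d / 2], [set i | i < d / 2]).
    split => /=; last exact: nbhs_right_lt.
    have cm : {for x, continuous (fun x' : R * R => mk x'.1 x'.2 : C)}.
      by apply: cts_mk; [exact: cvg_fst | exact: cvg_snd].
    exact: (near_pull cm (near_norm1 z0 d20)).
  move=> [x' i] /= [hx' hi] w hw.
  set z : C := mk x'.1 x'.2 in hx' hw *.
  have -> : F w / F z = (F w / F z0) / (F z / F z0).
    by rewrite invf_div mulrA mulfVK.
  apply: re_div_sector; apply: hd.
    have -> : w - z0 = (w - z) + (z - z0) by rewrite addrA subrK.
    apply: le_trans (norm1D _ _) _.
    by rewrite [leRHS]splitr lerD // ltW // (le_lt_trans hw).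
  by rewrite (le_trans (ltW hx')) // ler_pdivrMr // ler_peMr ?ltW // ltr1n.
have near0 := (compact_near_coveringP K).1 cK R (0^'+) P (at_right_proper_filter 0) loc.
have [d [/= d0 hd]] := @filter_ex _ (0^'+) _ _ (filterI (nbhs_right_gt 0) near0).
exists d => // z w zn.
have zK : K (re z, im z).
  have := zn; rewrite /norm1 /K /= !in_itv /= -!ler_norml => zn'; split.
    by apply: le_trans zn'; rewrite lerDl.
  by apply: le_trans zn'; rewrite lerDr.
by have := hd _ zK w; rewrite /= mkE.
Qed.

(* The root multiplies principal roots of the ratios of F along a fine
   subdivision of the segment from 0 to z. *)
Lemma kroot_ball (k : nat) (F : C -> C) (n : R) (c0 : C) : (0 < k)%N -> 0 < n ->
  continuous F -> (forall z, F z != 0) -> c0 ^+ k = F 0 ->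
  exists r : C -> C, [/\ continuous r, r 0 = c0 &
    forall z, norm1 z <= n -> r z ^+ k = F z].
Proof.
move=> k0 n0 cF F0 c0k.
have [d d0 hd] := uniform_ratio cF F0 n.
(* The number of subdivision steps: each then has [norm1]-length at most [n / N <= d]. *)
pose N := (Num.bound (n / d)).+1.
have Nd : n / N%:R <= d.
  rewrite ler_pdivrMr ?ltr0n // mulrC -ler_pdivrMr //.
  apply/ltW/(lt_le_trans (archi_boundP (divr_ge0 (ltW n0) (ltW d0)))).
  by rewrite ler_nat.
pose u (j : nat) (z : C) := radial n z * rc (j%:R / N%:R).
have cu j : continuous (u j).
  have h z : {for z, continuous (u j)}.
    apply: ctsM; [exact: radial_cont | exact: cts_cst].
  exact: h.
pose q j z := F (u j.+1 z) / F (u j z).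
have q_gt0 j z : (j < N)%N -> 0 < re (q j z).
  move=> jN; apply: hd.
    rewrite norm1_rc ?divr_ge0 //.
    apply: le_trans (norm1_radial n0 z); rewrite ler_piMr ?addr_ge0 //.
    by rewrite ler_pdivrMr ?ltr0n // mul1r ler_nat ltnW.
  rewrite /u -mulrBr.
  have -> : rc (j.+1%:R / N%:R) - rc (j%:R / N%:R) = rc (N%:R^-1) :> C.
    by apply: ceqP; rewrite !cE ?oppr0 ?addr0 // -mulrBl -natr1 addrAC subrr add0r mul1r.
  rewrite norm1_rc ?invr_ge0 //; apply: le_trans Nd.
  by rewrite ler_wpM2r ?invr_ge0 // norm1_radial.
have cq j : continuous (q j).
  have h z : {for z, continuous (q j)}.
    apply: ctsM; first by apply: (cts_comp (@cu _ z)); exact: cF.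
    by apply: ctsV => //; apply: (cts_comp (@cu _ z)); exact: cF.
  exact: h.
have u00 j : u j 0 = 0 by rewrite /u radial0 mul0r.
exists (fun z => c0 * \prod_(j < N) kroot k (q j z)); split.
- have h z : {for z, continuous (fun z => c0 * \prod_(j < N) kroot k (q j z))}.
    apply: ctsM; first exact: cts_cst.
    apply: (@cts_prod _ _ _ (fun j z => kroot k (q j z))) => j jN.
    by apply: (cts_comp (@cq j z)); apply: kroot_cont; exact: q_gt0.
  exact: h.
- rewrite big1 ?mulr1 // => j _.
  by rewrite /q !u00 divff // kroot1.
- move=> z zn.
  rewrite exprMn c0k -prodrXl.
  rewrite (eq_bigr (fun j : 'I_N => F (u j.+1 z) / F (u j z))); last first.
    by move=> j _; rewrite krootK // q_gt0.
  rewrite -(big_mkord predT (fun j => F (u j.+1 z) / F (u j z))).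
  rewrite (@telescope_prodf _ 0 N (fun j => F (u j z))) //.
  rewrite /u mul0r mulr0 mulrC mulfVK // divff ?pnatr_eq0 //.
  have -> : rc 1 = 1 by [].
  by rewrite mulr1 radial_id.
Qed.

Lemma roots_eq (k : nat) (r1 r2 : C -> C) : (0 < k)%N ->
  continuous r1 -> continuous r2 -> (forall z, r2 z != 0) ->
  (forall z, r1 z ^+ k = r2 z ^+ k) -> r1 0 = r2 0 -> r1 = r2.
Proof.
move=> k0 c1 c2 nz e e0; apply/funext => z.
apply: (mulIf (invr_neq0 (nz z))); rewrite divff //.
have lc x : \forall y \near x, r1 y / r2 y = r1 x / r2 x.
  apply: (@unity_loc_const _ _ (fun y => r1 y / r2 y) k _ k0).
    by apply: ctsM; [exact: c1 | apply: ctsV => //; exact: c2].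
  by apply: filterE => y; rewrite exprMn exprVn e divff // expf_neq0.
by rewrite (loc_const_C lc z 0) e0 divff.
Qed.

(** The roots on growing balls share their value at 0, so they agree on common balls and glue. *)
Lemma root_plane (k : nat) (F : C -> C) : (0 < k)%N ->
  continuous F -> (forall z, F z != 0) ->
  exists2 r : C -> C, continuous r & forall z, r z ^+ k = F z.
Proof.
move=> k0 cF F0.
have [c0 c0k] := closed_root (F 0) k0.
have /choice[r hr] (n : nat) : exists r : C -> C, [/\ continuous r, r 0 = c0 &
    forall z, norm1 z <= n.+1%:R -> r z ^+ k = F z].
  by apply: kroot_ball.
have req n m z : norm1 z <= n.+1%:R -> norm1 z <= m.+1%:R -> r n z = r m z.
  wlog nm : n m / (n <= m)%N.
    by move=> h hn hm; case: (leqP n m) => [/h|/ltnW/h->]; first exact.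
  move=> hn _.
  have [[cn n0 kn] [cm m0 km]] := (hr n, hr m).
  have nz0 : 0 < n.+1%:R :> R by [].
  have kn' y : r n (radial n.+1%:R y) ^+ k = F (radial n.+1%:R y).
    by rewrite kn ?norm1_radial.
  have km' y : r m (radial n.+1%:R y) ^+ k = F (radial n.+1%:R y).
    by rewrite km // (le_trans (norm1_radial _ _)) // ler_nat.
  (* Both roots are compared after the retraction onto the smaller ball, because [roots_eq] speaks
     of functions on the whole plane. *)
  have e : (fun y => r n (radial n.+1%:R y)) = (fun y => r m (radial n.+1%:R y)).
    apply: (roots_eq k0).
    - have h y : {for y, continuous (fun y => r n (radial n.+1%:R y))}.
        by apply: cts_comp; [exact: radial_cont | exact: cn].
      exact: h.
    - have h y : {for y, continuous (fun y => r m (radial n.+1%:R y))}.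
        by apply: cts_comp; [exact: radial_cont | exact: cm].
      exact: h.
    - by move=> y; have := F0 (radial n.+1%:R y); rewrite -km' expf_eq0 k0.
    - by move=> y; rewrite kn' km'.
    - by rewrite radial0 n0 m0.
  by have := congr1 (fun f => f z) e; rewrite radial_id.
pose b (z : C) := Num.bound (norm1 z).
have hb z : norm1 z <= (b z).+1%:R.
  apply/ltW/(lt_le_trans (archi_boundP (addr_ge0 (normr_ge0 _) (normr_ge0 _)))).
  by rewrite ler_nat.
exists (fun z => r (b z) z); last by move=> z; have [_ _ ->] := hr (b z).
have h z : {for z, continuous (fun z => r (b z) z)}.
  (* The index is raised by one so that a single root serves on a whole unit neighbourhood of [z],
     where [b] varies. *)
  have [cb _ _] := hr (b z).+1.
  apply: (@cts_near _ _ (r (b z).+1)); last exact: cb.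
  apply: filterS (near_norm1 z ltr01) => w wz; apply: req => //.
  rewrite -(subrK z w) (le_trans (norm1D _ _)) // -natr1 addrC lerD // ltW //.
exact: h.
Qed.
End Roots.

(** * Roots in the presence of punctures *)

Section LocalRoots.
Variable R : realType.
Local Notation C := (Cplane R).
Implicit Types z w p : C.

(* A root of F on the punctured neighbourhood of p, extended by a retraction,
   can be divided out of F; the quotient extends over p by 1. *)
Lemma root_off (k : nat) (P : seq C) (F : C -> C) : (0 < k)%N ->
  (forall z, z \notin P -> {for z, continuous F} /\ F z != 0) ->
  (forall p, p \in P -> exists r : C -> C,
     \forall z \near p^', {for z, continuous r} /\ r z ^+ k = F z) ->
  exists r : C -> C, forall z, z \notin P -> {for z, continuous r} /\ r z ^+ k = F z.
Proof.
move=> k0; elim: P F => [|p P IH] F cF lF.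
  have [z||r cr rk] := @root_plane R k F k0.
  - by case: (cF z).
  - by move=> z; case: (cF z).
  - by exists r => z _; split; [exact: cr | exact: rk].
have [pP|pP] := boolP (p \in P).
  have e x : (x \notin p :: P) = (x \notin P).
    by rewrite inE; have [->|] := eqVneq x p; rewrite ?pP.
  have [|q qP|r hr] := IH F.
  - by move=> z zP; apply: cF; rewrite e.
  - by apply: lF; rewrite inE qP orbT.
  - by exists r => z; rewrite e; exact: hr.
have [r0 hr0] := lF p (mem_head _ _).
have near0 : \forall z \near p^', (r0 z ^+ k = F z /\ {for z, continuous r0}) /\ z \notin p :: P.
  by have := near_notin (p :: P) p; apply: filterS2 hr0 => z [].
have [c [cc cp cid]] := clamp near0.
pose r1 z := r0 (c z).
have cr1 z : z != p -> {for z, continuous r1}.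
  by move=> /cp[_ [[_ cz] _]]; apply: (cts_comp (cc z)).
have r1n z : z != p -> r1 z != 0.
  move=> /cp[_ [[e _] /cF[_]]]; rewrite -e; apply: contra_neq => h.
  by rewrite /r1 in h; rewrite h expr0n gtn_eqF.
pose G z := if z == p then 1 else F z / r1 z ^+ k.
have Gp : \forall z \near p, G z = 1.
  apply: filterS cid => z cz; rewrite /G; case: eqVneq => // zp.
  have [_ [[e _] _]] := cp z zp.
  by rewrite /r1 e cz divff //; have [_] := cF (c z) (proj2 (proj2 (cp z zp))); rewrite cz.
have Gz z : z != p -> \forall w \near z, F w / r1 w ^+ k = G w.
  move=> zp; have : \forall w \near z, w \notin [:: p] by apply: near_notin_out; rewrite inE.
  by apply: filterS => w; rewrite inE /G => /negbTE ->.
have [||r hr] := IH G.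
- move=> z zP; have [->|zp] := eqVneq z p.
    split; last by rewrite /G eqxx oner_neq0.
    by apply: (@cts_near _ _ (fun=> 1 : C)); [apply: filterS Gp => w -> | exact: cts_cst].
  have [|cz z0] := cF z; first by rewrite inE negb_or zp.
  split; last by rewrite /G (negbTE zp) mulf_neq0 ?z0 // invr_neq0 // expf_neq0 // r1n.
  apply: (cts_near (Gz z zp)); apply: ctsM; first exact: cz.
  by apply: ctsV; [rewrite expf_neq0 // r1n | apply: ctsX; exact: cr1].
- move=> s sP; have sp : s != p by apply: contraNneq pP => <-.
  have [|r hr] := lF s; first by rewrite inE sP orbT.
  exists (fun z => r z / r1 z).
  have h := near_notin [:: p] s.
  apply: filterS2 hr h => z [cz rk]; rewrite inE => zp; split.
    by apply: ctsM; [exact: cz | apply: ctsV; [exact: r1n | exact: cr1]].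
  by rewrite /G (negbTE zp) exprMn exprVn rk.
- exists (fun z => r z * r1 z) => z; rewrite inE negb_or => /andP[zp zP].
  have [cz rk] := hr z zP; split; first by apply: ctsM; [exact: cz | exact: cr1].
  by rewrite exprMn rk /G (negbTE zp) mulfVK // expf_neq0 // r1n.
Qed.

(** For a period [T] of [cexp], the quotient [q (z + T) / q z] is a constant k-th root of unity, so
    k shifts leave [q] unchanged. Hence q(kz) descends through [cexp] even where [q] itself does
    not. *)
Lemma root_shift (k : nat) (q : C -> C) (s t : C) : (0 < k)%N -> continuous q ->
  (forall z, q z != 0) -> (forall z w, cexp z = cexp w -> q z ^+ k = q w ^+ k) ->
  cexp s = cexp t -> q (s *+ k) = q (t *+ k).
Proof.
move=> k0 cq q0 qk st; pose T := s - t.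
have eT z : cexp (z + T) = cexp z.
  have e1 : cexp T * cexp t = 1 * cexp t by rewrite -cexpD subrK mul1r st.
  by rewrite cexpD (mulIf (cexp_neq0 t) e1) mulr1.
pose g z := q (z + T) / q z.
have gk z : g z ^+ k = 1 by rewrite exprMn exprVn (qk _ _ (eT z)) divff // expf_neq0.
have lc x : \forall y \near x, g y = g x.
  apply: (@unity_loc_const _ _ g k _ k0); last exact: filterE.
  apply: ctsM; last by apply: ctsV; [exact: q0 | exact: cq].
  apply: (@cts_comp _ _ _ (fun z => z + T)); last exact: cq.
  by apply: ctsD; [exact: cts_id | exact: cts_cst].
have shift z : q (z + T) = g 0 * q z.
  by rewrite (loc_const_C lc 0 z) /g mulfVK.
have -> : s *+ k = t *+ k + T *+ k by rewrite -mulrnDl addrC subrK.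
have h j : q (t *+ k + T *+ j) = g 0 ^+ j * q (t *+ k).
  elim: j => [|j IHj]; first by rewrite mulr0n addr0 expr0 mul1r.
  by rewrite mulrSr addrA shift IHj exprS mulrA.
by rewrite h gk mul1r.
Qed.

(* theta (w ^+ k) has a k-th root around 0 because w |-> w ^+ k multiplies
   winding numbers by k. *)
Lemma root_punctured (k : nat) (theta : C -> C) : (0 < k)%N ->
  (\forall w \near 0^', {for w, continuous theta} /\ theta w != 0) ->
  exists2 rho : C -> C, forall w, w != 0 -> {for w, continuous rho} &
    \forall w \near 0^', rho w ^+ k = theta (w ^+ k).
Proof.
move=> k0 /clamp[c [cc cp cid]].
have ctheta w : w != 0 -> {for w, continuous (fun z => theta (c z))}.
  by move=> /cp[_ [cw _]]; exact: (cts_comp (cc w)).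
have [||q cq qk] := @root_plane R k (fun s => theta (c (cexp s))) k0.
- have h s : {for s, continuous (fun s => theta (c (cexp s)))}.
    apply: (@cts_comp _ _ _ (@cexp R) (fun z => theta (c z))); first exact: cexp_cont.
    by apply: ctheta; exact: cexp_neq0.
  exact: h.
- by move=> s; have [_ []] := cp _ (cexp_neq0 s).
have q0 z : q z != 0.
  have [_ [_]] := cp _ (cexp_neq0 z); rewrite -qk; apply: contra_neq => ->.
  by rewrite expr0n gtn_eqF.
(* [L] is an arbitrary, possibly discontinuous logarithm; [qL] makes the choice invisible in
   [q (L w *+ k)]. *)
have /choice[L hL] (w : C) : exists s, w != 0 -> cexp s = w.
  have [->|/cexp_surj[s hs]] := eqVneq w 0; first by exists 0.
  by exists s.
have qL s t : cexp s = cexp t -> q (s *+ k) = q (t *+ k).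
  by apply: root_shift => // z w zw; rewrite !qk zw.
exists (fun w => q (L w *+ k)).
  move=> w w0.
  have c1 : {for w, continuous (fun z => z / w)}.
    by apply: ctsM; [exact: cts_id | exact: cts_cst].
  (* Near [w], the continuous branch [L w + clog (z / w)] may replace [L z]. *)
  have c2 : {for w, continuous (fun z => q (k%:R * (L w + clog (z / w))))}.
    apply: (@cts_comp _ _ _ (fun z => k%:R * (L w + clog (z / w)))); last exact: cq.
    apply: ctsM; first exact: cts_cst.
    apply: ctsD; first exact: cts_cst.
    by apply: (cts_comp c1); apply: clog_cont; rewrite divff // re1.
  apply: cts_near c2.
  have pos : \forall z \near w, 0 < re (z / w).
    have h := @cvgr_gt _ _ _ _ _ _ (cts_re c1) 0.
    by apply: h; rewrite divff // re1.
  have nz : \forall z \near w, z != 0 by apply: cts_nz; [exact: cts_id | exact: w0].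
  apply: filterS2 pos nz => z zw z0.
  rewrite mulr_natl; apply: qL.
  by rewrite cexpD clogK // hL // hL // mulrC mulfVK.
have ck : {for (0 : C), continuous (fun w => w ^+ k)} by apply: ctsX; exact: cts_id.
have := @near_pull _ _ _ (fun z => c z = z) _ ck.
rewrite expr0n gtn_eqF // => /(_ cid) h.
apply: dnbhs_near; apply: filterS h => w hw w0.
by rewrite qk cexpMn hL // hw.
Qed.
End LocalRoots.

(** * Lifting through the dihedral map *)

Section DihedralLift.
Variable R : realType.
Local Notation C := (Cplane R).
Implicit Types z w p : C.

(** At a zero of [g] no choice of sign can break continuity, since the square of the modulus of [f]
    is that of [g] and tends to 0. This treats the points where [F ^+ 2 = 1]. *)
Lemma cts_sqrt0 (X : topologicalType) (f g : X -> C) (x : X) :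
  (\forall y \near x, f y ^+ 2 = g y) -> g x = 0 -> {for x, continuous g} ->
  {for x, continuous f}.
Proof.
move=> fg gx cg.
have fx : f x = 0 by have /eqP := nbhs_singleton fg; rewrite gx expf_eq0 => /eqP.
suff h : f @ x --> (0 : C) by rewrite /prop_for /continuous_at fx.
apply: (@cvgrPdist_lt _ _ _ (nbhs x) _ f 0).2 => e e0.
have e20 : 0 < e ^+ 2 by rewrite exprn_gt0.
rewrite /prop_for /continuous_at gx in cg.
have h := (@cvgrPdist_lt _ _ _ (nbhs x) (nbhs_filter x) g 0).1 cg _ e20.
apply: filterS2 fg h => y <-.
by rewrite !sub0r !normrN normrX ltr_pXn2r // nnegrE ltW.
Qed.

Lemma cts_re_pos (X : topologicalType) (f : X -> C) (x : X) :
  {for x, continuous f} -> 0 < re (f x) -> \forall y \near x, 0 < re (f y).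
Proof. by move=> /cts_re cf f0; exact: (@cvgr_gt _ _ _ _ _ _ cf 0 f0). Qed.

(* The lift is h = u^(1/k) with u = F + sqrt (F^2 - 1). *)
Lemma dihedral_lift (k : nat) (F : C -> C) (P Q : seq C) : (0 < k)%N ->
  (forall z, z \notin P -> {for z, continuous F}) ->
  (forall s, s \in P -> \forall z \near s^', F z != 0 /\ 0 < re (1 - F z ^- 2)) ->
  (forall s, s \in P -> exists r : C -> C,
     \forall z \near s^', {for z, continuous r} /\ r z ^+ k = F z) ->
  (forall z, z \notin P -> F z ^+ 2 = 1 -> z \in Q) ->
  (forall s, s \notin P -> F s ^+ 2 = 1 -> exists r : C -> C,
     \forall z \near s^', {for z, continuous r} /\ r z ^+ 2 = F z ^+ 2 - 1) ->
  exists h : C -> C, forall z, z \notin P ->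
    [/\ {for z, continuous h}, h z != 0 & h z ^+ k + h z ^- k = F z *+ 2].
Proof.
move=> k0 cF poleF rootF onesQ sqrtF.
pose Q' := [seq z <- Q | F z ^+ 2 == 1].
have [||w0 hw0] := @root_off R 2 (P ++ Q') (fun z => F z ^+ 2 - 1) isT.
- move=> z; rewrite mem_cat negb_or => /andP[zP zQ]; split.
    by apply: ctsB; [apply: ctsX; exact: cF | exact: cts_cst].
  rewrite subr_eq0; apply: contra zQ => F1.
  by rewrite mem_filter F1 onesQ //; apply/eqP.
- move=> s sPQ; have [sP|sP] := boolP (s \in P); last first.
    apply: sqrtF => //; move: sPQ.
    by rewrite mem_cat (negbTE sP) mem_filter => /andP[/eqP].
  (* Near a pole, [F ^+ 2 - 1] is [F ^+ 2] times [1 - F ^- 2], and the second factor lies in the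
     right half-plane. *)
  exists (fun z => F z * kroot 2 (1 - F z ^- 2)).
  apply: filterS2 (poleF s sP) (near_notin P s) => z [Fz0 pos] zP; split.
    apply: ctsM; first exact: cF.
    apply: (@cts_comp _ _ _ (fun z => 1 - F z ^- 2)); last exact: kroot_cont.
    apply: ctsB; first exact: cts_cst.
    by apply: ctsV; [rewrite expf_neq0 | apply: ctsX; exact: cF].
  by rewrite exprMn krootK // mulrBr mulr1 divff // expf_neq0.
(* [w0] is not controlled at the zeros of [F ^+ 2 - 1], where a square root has to vanish. *)
pose w z := if F z ^+ 2 == 1 then 0 else w0 z.
have w2 z : z \notin P -> w z ^+ 2 = F z ^+ 2 - 1.
  move=> zP; rewrite /w; case: eqVneq => [->|Fz]; first by rewrite expr0n subrr.
  by apply: (proj2 (hw0 z _)); rewrite mem_cat mem_filter (negbTE Fz) orbF.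
have cw z : z \notin P -> {for z, continuous w}.
  move=> zP.
  have cF2 : {for z, continuous (fun z => F z ^+ 2 - 1)}.
    by apply: ctsB; [apply: ctsX; exact: cF | exact: cts_cst].
  have [Fz|Fz] := eqVneq (F z ^+ 2) 1.
    apply: (@cts_sqrt0 _ _ (fun z => F z ^+ 2 - 1)); [|by rewrite Fz subrr|exact: cF2].
    by apply: filterS (near_notin_out zP) => y; exact: w2.
  apply: (@cts_near _ _ w0); last first.
    by apply: (proj1 (hw0 z _)); rewrite mem_cat mem_filter (negbTE Fz) orbF.
  apply: filterS (cts_nz cF2 _) => [y|]; last by rewrite subr_eq0.
  by rewrite subr_eq0 /w => /negbTE ->.
have uV z : z \notin P -> (F z + w z) * (F z - w z) = 1.
  by move=> zP; rewrite mulrC -subr_sqr w2 // subKr.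
have [||h hh] := @root_off R k P (fun z => F z + w z) k0.
- move=> z zP; split; first by apply: ctsD; [exact: cF | exact: cw].
  by apply: contra_eqN (uV z zP) => /eqP ->; rewrite mul0r eq_sym oner_eq0.
- move=> s sP; have [r hr] := rootF s sP.
  (* [v ^+ 2 = 1 - F ^- 2] has positive real part, so [re v] cannot vanish and keeps its sign near
     [s]. If it is positive, the root is taken of [F + w], which is [F] times [1 + v]; otherwise of
     the inverse [F - w], which is [F] times [1 - v]. The factor next to [F] is then in the right
     half-plane. *)
  pose v z := w z / F z.
  have near_s : \forall z \near s^', [/\ z \notin P, F z != 0 & 0 < re (v z ^+ 2)].
    apply: filterS2 (poleF s sP) (near_notin P s) => z [Fz0 pos] zP; split=> //.
    by rewrite exprMn exprVn w2 // mulrBl divff ?expf_neq0 // mul1r.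
  have cv z : z \notin P -> F z != 0 -> {for z, continuous v}.
    by move=> zP Fz0; apply: ctsM; [exact: cw | apply: ctsV; [exact: Fz0 | exact: cF]].
  have [|b hb] := @loc_const_punctured R bool (fun z => 0 < re (v z)) s.
    apply: filterS near_s => z [zP Fz0 pos].
    have [vp|vn|v0] := ltrgtP 0 (re (v z)).
    - by apply: filterS (cts_re_pos (cv z zP Fz0) vp) => y ->.
    - have h : 0 < re (- v z) by rewrite reN oppr_gt0.
      apply: filterS (cts_re_pos (ctsN (cv z zP Fz0)) h) => y.
      by rewrite reN oppr_gt0 => h'; apply/negbTE; rewrite -leNgt ltW.
    - by move: pos; rewrite expr2 reM -v0 mulr0 sub0r oppr_gt0 -expr2 ltNge sqr_ge0.
  case: b hb => hb.
    exists (fun z => r z * kroot k (1 + v z)).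
    near=> z.
    have [zP Fz0 _] : [/\ z \notin P, F z != 0 & 0 < re (v z ^+ 2)] by near: z.
    have vp : 0 < re (v z) by near: z.
    have [cr rk] : {for z, continuous r} /\ r z ^+ k = F z by near: z.
    have v1 : 0 < re (1 + v z) by rewrite reD re1 addr_gt0.
    split.
      apply: ctsM; first exact: cr.
      apply: (@cts_comp _ _ _ (fun z => 1 + v z)); last exact: kroot_cont.
      by apply: ctsD; [exact: cts_cst | exact: cv].
    by rewrite exprMn rk krootK // mulrDr mulr1 mulrCA divff // mulr1.
  exists (fun z => (r z * kroot k (1 - v z))^-1).
  near=> z.
  have [zP Fz0 _] : [/\ z \notin P, F z != 0 & 0 < re (v z ^+ 2)] by near: z.
  have vp : (0 < re (v z)) = false by near: z.
  have [cr rk] : {for z, continuous r} /\ r z ^+ k = F z by near: z.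
  have v1 : 0 < re (1 - v z) by rewrite reD reN re1 ltr_wpDr // oppr_ge0 leNgt vp.
  have e : (r z * kroot k (1 - v z)) ^+ k = F z - w z.
    by rewrite exprMn rk krootK // mulrBr mulr1 mulrCA divff // mulr1.
  have nz : F z - w z != 0.
    by apply: contra_eqN (uV z zP) => /eqP ->; rewrite mulr0 eq_sym oner_eq0.
  split.
    apply: ctsV; first by apply: contra_neq nz => h0; rewrite -e h0 expr0n gtn_eqF.
    apply: ctsM; first exact: cr.
      apply: (@cts_comp _ _ _ (fun z => 1 - v z)); last exact: kroot_cont.
    by apply: ctsB; [exact: cts_cst | exact: cv].
  by rewrite exprVn e; apply: (mulIf nz); rewrite mulVf // uV.
- exists h => z zP; have [ch hk] := hh z zP; have := uV z zP; rewrite -hk => hu.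
  have hk0 : h z ^+ k != 0 by apply: contra_eqN hu => /eqP ->; rewrite mul0r eq_sym oner_eq0.
  split=> //; first by move: hk0; rewrite expf_eq0 k0.
  have -> : h z ^- k = F z - w z by apply: (mulfI hk0); rewrite divff // hu.
  by rewrite hk addrACA subrr addr0.
Unshelve. all: by end_near. Qed.
End DihedralLift.

(** * Fibres and local injectivity of the dihedral quotient map *)

Section DihedralMap.
Variable R : realType.
Local Notation C := (Cplane R).
Implicit Types z w p : C.

Definition gmap (k : nat) z : C := (z ^+ k + z ^- k) / 2.

Lemma gmapE k z y : (z ^+ k + z ^- k = y *+ 2) <-> gmap k z = y.
Proof.
have normsq : (2 : C) != 0 by rewrite pnatr_eq0.
rewrite /gmap; split=> [->|<-]; first by rewrite -mulr_natr mulfK.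
by rewrite -mulr_natr mulfVK.
Qed.

Lemma addV_eq (a b : C) : a != 0 -> b != 0 -> a + a^-1 = b + b^-1 ->
  a = b \/ a * b = 1.
Proof.
move=> a0 b0 e; have : (a - b) * (a * b - 1) = 0.
  have -> : (a - b) * (a * b - 1) = a * b * ((a + a^-1) - (b + b^-1)) by field; rewrite a0 b0.
  by rewrite e subrr mulr0.
move/eqP; rewrite mulf_eq0 !subr_eq0 => /orP[/eqP h|/eqP h]; [by left|by right].
Qed.

Lemma gmap_eq k z w : z != 0 -> w != 0 -> gmap k z = gmap k w ->
  z ^+ k = w ^+ k \/ z ^+ k * w ^+ k = 1.
Proof.
by move=> z0 w0 /gmapE; rewrite -(gmapE k w _).2 // => /addV_eq; apply; rewrite expf_neq0.
Qed.

Lemma gmap_unit k z : z != 0 -> z ^+ k * z ^+ k = 1 -> gmap k z ^+ 2 = 1.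
Proof.
move=> z0 h; have zk0 : z ^+ k != 0 by rewrite expf_neq0.
have -> : gmap k z = z ^+ k; last by rewrite expr2.
apply/gmapE; rewrite mulr2n; congr (_ + _).
by apply: (mulfI zk0); rewrite divff.
Qed.

Lemma gmap_cont k z : z != 0 -> {for z, continuous (gmap k)}.
Proof.
move=> z0; have cX : {for z, continuous (fun z => z ^+ k)} by apply: ctsX; exact: cts_id.
apply: ctsM; last exact: cts_cst.
by apply: ctsD; [exact: cX | apply: ctsV; [rewrite expf_neq0 | exact: cX]].
Qed.

(** [z ^+ k] has to be one of the two roots of X^2 - 2yX + 1, which are mutually inverse and
    distinct unless y^2 = 1; each has k roots. The condition [z != 0] discards the spurious value of
    [gmap] at 0 that results from [0^-1 = 0]. *)
Lemma gmap_fibre (k : nat) (y : C) : (0 < k)%N -> exists s : seq C,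
  [/\ uniq s, forall z, (z \in s) <-> (z != 0 /\ gmap k z = y) &
      y ^+ 2 != 1 -> size s = (2 * k)%N].
Proof.
move=> k0; have [w w2] := @closed_root R 2 (y ^+ 2 - 1) isT.
pose u := y + w.
have uV : u * (y - w) = 1 by rewrite mulrC -subr_sqr w2 subKr.
have u0 : u != 0 by apply: contra_eqN uV => /eqP ->; rewrite mul0r eq_sym oner_eq0.
have uVE : u^-1 = y - w by apply: (mulfI u0); rewrite divff.
have uy : u + u^-1 = y *+ 2 by rewrite uVE addrACA subrr addr0.
have [s1 [us1 ss1 hs1]] := nth_roots k0 u0.
have [s2 [us2 ss2 hs2]] := nth_roots k0 (invr_neq0 u0).
exists (undup (s1 ++ s2)); split; first exact: undup_uniq.
- move=> z; rewrite mem_undup mem_cat hs1 hs2 -gmapE; split.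
    have [->|z0] := eqVneq z 0.
      by rewrite expr0n gtn_eqF //= eq_sym (negbTE u0) eq_sym invr_eq0 (negbTE u0).
    by case/orP => /eqP ->; split=> //; rewrite ?invrK // addrC.
  move=> [z0 e]; case: (@addV_eq (z ^+ k) u) => //; first by rewrite expf_neq0.
  - by rewrite e uy.
  - by move->; rewrite eqxx.
  - by move=> h; apply/orP; right; apply/eqP/(mulIf u0); rewrite mulVf.
- move=> y1; rewrite undup_id ?size_cat ?ss1 ?ss2 ?mul2n ?addnn //.
  rewrite cat_uniq us1 us2 andbT; apply/hasPn => z; rewrite hs2 hs1 => /eqP ->.
  apply: contra y1 => /eqP e; have w0 : w = - w by apply: (addrI y); rewrite -/u -uVE.
  have : u * u = 1 by rewrite -[X in X * _]e mulVf.
  have w00 : w = 0.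
    have /eqP : w *+ 2 = 0 by rewrite mulr2n {1}w0 addNr.
    by rewrite mulrn_eq0 => /eqP.
  by rewrite /u w00 addr0 -expr2 => ->.
Qed.

Lemma pair_near (f : C * C -> C) (P : set C) z : {for (z, z), continuous f} ->
  (\forall w \near f (z, z), P w) ->
  exists2 W : set C, nbhs z W & forall a b, W a -> W b -> P (f (a, b)).
Proof.
move=> cf /(near_pull cf)[[A B] /= [zA zB] AB].
exists (A `&` B); first exact: filterI.
by move=> a b [Aa _] [_ Bb]; apply: (AB (a, b)).
Qed.

(** For [a] and [b] both close to [z], [a / b] is a k-th root of unity close to 1. *)
Lemma pow_inj_near (k : nat) z : (0 < k)%N -> z != 0 -> exists2 W : set C, nbhs z W &
  forall a b, W a -> W b -> a ^+ k = b ^+ k -> a = b.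
Proof.
move=> k0 z0.
have c1 : {for (z, z), continuous (fun p : C * C => p.1 / p.2)}.
  by apply: ctsM; [exact: cvg_fst | apply: ctsV; [exact: z0 | exact: cvg_snd]].
have h : \forall v \near (z / z), v ^+ k = 1 -> v = 1.
  by rewrite divff //; exact: near_unity.
have nz : \forall a \near z, a != 0 by apply: cts_nz; [exact: cts_id | exact: z0].
have [W zW hW] := pair_near c1 h.
exists (W `&` [set a | a != 0]); first exact: filterI.
move=> a b [Wa a0] [Wb b0] ab; have := hW a b Wa Wb; rewrite /= exprMn exprVn ab.
rewrite divff ?expf_neq0 // => /(_ erefl) e.
by rewrite -(mulfVK b0 a) e mul1r.
Qed.

(** Of the two cases of [gmap_eq], the product equal to 1 is excluded near [z]: at [a = b = z] it
    would give [gmap k z] the value 1 or -1, and the product is continuous. *)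
Lemma gmap_inj_near (k : nat) z : (0 < k)%N -> z != 0 -> gmap k z ^+ 2 != 1 ->
  exists2 W : set C, nbhs z W &
  forall a b, W a -> W b -> gmap k a = gmap k b -> a = b.
Proof.
move=> k0 z0 g1.
have [W1 zW1 hW1] := pow_inj_near k0 z0.
have c1 : {for (z, z), continuous (fun p : C * C => p.1 ^+ k * p.2 ^+ k - 1)}.
  apply: ctsB; last exact: cts_cst.
  by apply: ctsM; apply: ctsX; [exact: cvg_fst | exact: cvg_snd].
have [|W2 zW2 hW2] := pair_near (P := fun v => v != 0) c1.
  apply: cts_nz; first exact: cts_id.
  by rewrite /= subr_eq0; apply: contra_neq g1; exact: gmap_unit.
have nz : \forall a \near z, a != 0 by apply: cts_nz; [exact: cts_id | exact: z0].
exists (W1 `&` W2 `&` [set a | a != 0]).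
  by apply: filterI => //; exact: filterI.
move=> a b [[W1a W2a] a0] [[W1b W2b] b0] /gmap_eq => /(_ a0 b0)[|e]; first exact: hW1.
by have := hW2 a b W2a W2b; rewrite /= e subrr eqxx.
Qed.
End DihedralMap.

(** * Fibres of the lift *)

Section Counting.

Lemma near_all_seq (I : eqType) (T : Type) (F : set_system T) {FF : Filter F}
    (s : seq I) (P : I -> set T) :
  (forall i, i \in s -> \forall x \near F, P i x) ->
  \forall x \near F, forall i, i \in s -> P i x.
Proof.
elim: s => [|i s IH] h; first exact: filterE.
have hi : \forall x \near F, P i x by apply: h; rewrite mem_head.
have hs : \forall x \near F, forall i, i \in s -> P i x.
  by apply: IH => j js; apply: h; rewrite inE js orbT.
apply: filterS2 hi hs => x Pi Ps j.
by rewrite inE => /orP[/eqP ->|/Ps].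
Qed.

Lemma separate_seq (X : topologicalType) (t : seq X) : hausdorff_space X ->
  exists V : X -> set X, (forall x, x \in t -> nbhs x (V x)) /\
    forall x y z, x \in t -> y \in t -> V x z -> V y z -> x = y.
Proof.
move=> hX.
have /choice[A hA] (p : X * X) : exists A : set X * set X, p.1 != p.2 ->
    [/\ nbhs p.1 A.1, nbhs p.2 A.2 & forall z, A.1 z -> A.2 z -> False].
  have [->|pq] := eqVneq p.1 p.2; first by exists (setT, setT).
  by have [B [B' hB]] := hausdorff_near hX pq; exists (B, B').
exists (fun x => [set z | forall y, y \in t -> x != y -> (A (x, y)).1 z /\ (A (y, x)).2 z]).
split=> [x xt|x y z xt yt hx hy].
  apply: (near_all_seq (P := fun y z => x != y -> (A (x, y)).1 z /\ (A (y, x)).2 z)) => y yt.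
  have [->|xy] := eqVneq x y; first by apply: filterE.
  have [h1 _ _] := hA (x, y) xy.
  have yx : y != x by rewrite eq_sym.
  have [_ h2 _] := hA (y, x) yx.
  by apply: filterS2 h1 h2 => z.
apply/eqP/negPn/negP => xy.
have [h1 _] := hx y yt xy.
have yx : y != x by rewrite eq_sym.
have [_ h2] := hy x xt yx.
by have [_ _] := hA (x, y) xy; apply; [exact: h1 | exact: h2].
Qed.

Lemma sum_count_le (T S : eqType) (h : T -> S) (s : seq S) (t : seq T) : uniq s ->
  (\sum_(z <- s) count (fun x => h x == z) t <= size t)%N.
Proof.
move=> us; elim: t => [|x t IH].
  by rewrite big1.
under eq_bigr do rewrite /=.
rewrite big_split /= -add1n leq_add //.
have -> : (\sum_(z <- s) (h x == z) = count_mem (h x) s)%N.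
  by rewrite -sum1_count [RHS]big_mkcond /=; apply: eq_bigr => z _; rewrite eq_sym; case: eqP.
by rewrite count_uniq_mem // leq_b1.
Qed.

Section Fibres.
Variables (R : realType) (X : topologicalType).
Local Notation C := (Cplane R).
(** In the application, [F] is [f] read in a coordinate of the target, [D] is the complement of the
    fibre over infinity, and [B] contains all finite branch values. *)
Variables (k d : nat) (D : set X) (F h : X -> C) (B : seq C).
Hypotheses (k0 : (0 < k)%N) (hX : hausdorff_space X).
Hypothesis ramified : forall y : C, y ^+ 2 = 1 -> y \in B.
Hypothesis fibreF : forall y, y \notin B ->
  exists t : seq X, [/\ uniq t, size t = d & forall x, x \in t <-> D x /\ F x = y].
Hypothesis openF : forall x, D x -> F x \notin B -> forall U : set X, nbhs x U ->
  \forall y \near F x, exists x', [/\ U x', D x' & F x' = y].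
Hypothesis lift : forall x, D x -> [/\ {for x, continuous h}, h x != 0 & gmap k (h x) = F x].

(** Each point of the fibre of [F] over [gmap k z] moves to a point over [gmap k z'] in its own
    neighbourhood; these exhaust the new fibre, as both have [d] points. If [h x = z], local
    injectivity of [gmap k] forces [h x' = z']; if not, separation keeps [h x'] away from [z']. *)
Lemma card_lift_fibre_near (z : C) (T : C -> seq X) : z != 0 -> gmap k z \notin B ->
  (forall y, y \notin B ->
     [/\ uniq (T y), size (T y) = d & forall x, x \in T y <-> D x /\ F x = y]) ->
  \forall z' \near z, count (fun x => h x == z') (T (gmap k z')) =
                      count (fun x => h x == z) (T (gmap k z)).
Proof.
move=> z0 gB hT; pose t := T (gmap k z).
have g1 : gmap k z ^+ 2 != 1 by apply: contraNneq gB; exact: ramified.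
have [ut st mt] := hT _ gB.
have /choice[U hU] (x : X) : exists U : set X, x \in t -> nbhs x U /\
    \forall z' \near z, forall x', U x' -> D x' -> F x' = gmap k z' ->
      (h x' == z') = (h x == z).
  case xt : (x \in t); last by exists setT.
  have [Dx Fx] := (mt x).1 xt.
  have [chx hx0 ghx] := lift Dx.
  have [hxz|hxz] := eqVneq (h x) z.
    have [W zW hW] := gmap_inj_near k0 z0 g1.
    exists (h @^-1` W) => _; split; first by apply: chx; rewrite hxz.
    apply: filterS zW => z' Wz' x' Wx' Dx' Fx'; apply/eqP.
    by apply: hW => //; have [_ _ ->] := lift Dx'.
  have [A [A' [hA zA' AA']]] := hausdorff_near (@norm_hausdorff _ C) hxz.
  exists (h @^-1` A) => _; split; first exact: chx.
  apply: filterS zA' => z' A'z' x' Ax' Dx' Fx'; apply/negbTE/eqP => e.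
  by apply: (AA' z') => //; rewrite -e.
have [V [hV VV]] := separate_seq t hX.
have cg := @gmap_cont R k z z0.
have near1 : \forall z' \near z, forall x, x \in t ->
    exists x', [/\ (U x `&` V x) x', D x' & F x' = gmap k z'].
  apply: (@near_all_seq X C (nbhs z) _ t (fun x z' =>
    exists x', [/\ (U x `&` V x) x', D x' & F x' = gmap k z'])) => x xt.
  have [Dx Fx] := (mt x).1 xt.
  have h1 : nbhs x (U x `&` V x) by apply: filterI; [exact: (hU x xt).1 | exact: hV].
  have := openF Dx _ h1; rewrite Fx => /(_ gB).
  exact: (near_pull cg).
have near2 : \forall z' \near z, forall x, x \in t -> forall x', U x x' -> D x' ->
    F x' = gmap k z' -> (h x' == z') = (h x == z).
  apply: (@near_all_seq X C (nbhs z) _ t (fun x z' => forall x', U x x' -> D x' ->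
    F x' = gmap k z' -> (h x' == z') = (h x == z))) => x xt.
  exact: (hU x xt).2.
have near3 : \forall z' \near z, gmap k z' \notin B.
  exact: (near_pull cg (near_notin_out gB)).
near=> z'.
have gB' : gmap k z' \notin B by near: z'.
have ex1 : forall x, x \in t -> exists x', [/\ (U x `&` V x) x', D x' & F x' = gmap k z'].
  by near: z'.
have e2 : forall x, x \in t -> forall x', U x x' -> D x' ->
    F x' = gmap k z' -> (h x' == z') = (h x == z) by near: z'.
have /choice[phi hphi] (x : X) : exists x', x \in t ->
    [/\ (U x `&` V x) x', D x' & F x' = gmap k z'].
  by case xt : (x \in t); [have [x' hx'] := ex1 x xt; exists x' | exists x].
have [ut' st' mt'] := hT _ gB'.
have inj : {in t &, injective phi}.
  move=> x y xt yt e; have [[_ Vx] _ _] := hphi x xt; have [[_ Vy] _ _] := hphi y yt.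
  by apply: (VV x y (phi x)) => //; rewrite e.
have sub : {subset map phi t <= T (gmap k z')}.
  by move=> _ /mapP[x xt ->]; have [_ Dx' Fx'] := hphi x xt; apply/mt'.
have um : uniq (map phi t) by rewrite map_inj_in_uniq.
have pm : perm_eq (map phi t) (T (gmap k z')).
  apply: uniq_perm => //.
  by have [] := uniq_min_size um sub; rewrite ?size_map ?st' ?st // => _.
rewrite -(permP pm) count_map; apply: eq_in_count => x xt /=.
by have [[Ux _] Dx' Fx'] := hphi x xt; exact: e2.
Unshelve. all: by end_near. Qed.

Lemma lift_degree : exists2 m : nat, (2 * k * m <= d)%N &
  forall (z : C) (t : seq X), z != 0 -> gmap k z \notin B -> uniq t ->
    (forall x, x \in t -> D x /\ h x = z) -> (size t <= m)%N.
Proof.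
have /choice[T hT] (y : C) : exists t : seq X, y \notin B ->
    [/\ uniq t, size t = d & forall x, x \in t <-> D x /\ F x = y].
  by case yB : (y \in B); [exists [::] | have [t ht] := fibreF (negbT yB); exists t].
have /choice[G hG] (y : C) := gmap_fibre y k0.
(* Off 0 and the preimages of [B] the fibre count is locally constant, and removing this finite set
   does not disconnect the plane. *)
pose S : seq C := 0 :: flatten [seq G y | y <- B].
have hS z : z \notin S <-> z != 0 /\ gmap k z \notin B.
  rewrite inE negb_or; split=> [/andP[z0 /flatten_mapP zB]|[z0 gB]].
    split=> //; apply/negP => gB; apply: zB; exists (gmap k z) => //.
    by have [_ -> _] := hG (gmap k z).
  rewrite z0; apply/flatten_mapP => -[y yB]; have [_ -> _] := hG y.
  by move=> [_ gy]; move: gB; rewrite gy yB.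
pose nu z := count (fun x => h x == z) (T (gmap k z)).
have cnu z w : z \notin S -> w \notin S -> nu z = nu w.
  by apply: loc_const_off => x /hS[x0 gx]; exact: card_lift_fibre_near.
have [z0 /= z0S] := filter_ex (near_notin S 0).
exists (nu z0) => [|z t zn0 gB ut ht].
  have [zn0 gB] := (hS z0).1 z0S.
  have [uG mG sG] := hG (gmap k z0).
  have [_ sT _] := hT _ gB.
  rewrite -sG; last by apply: contraNneq gB; exact: ramified.
  rewrite -[leqRHS]sT; apply: leq_trans (sum_count_le h (T (gmap k z0)) uG).
  have -> : (size (G (gmap k z0)) * nu z0 = \sum_(z <- G (gmap k z0)) nu z0)%N.
    by rewrite big_const_seq count_predT iter_addn_0 mulnC.
  rewrite leq_eqVlt; apply/orP; left; apply/eqP.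
  apply: eq_big_seq => z /mG[zn gz].
  by rewrite (cnu z0 z) /nu ?gz //; apply/hS; rewrite gz.
have zS : z \notin S by apply/hS.
rewrite (cnu z0 z) // /nu -size_filter; apply: uniq_leq_size => // x xt.
have [Dx hx] := ht x xt; rewrite mem_filter hx eqxx.
have [_ _ mT] := hT _ gB; apply/mT; split=> //.
by have [_ _ <-] := lift Dx; rewrite hx.
Qed.

Lemma local_degree_bound (p : X) (e : nat) : D p ->
  (forall U : set X, nbhs p U -> \forall y \near (F p)^', exists t : seq X,
     [/\ uniq t, size t = e & forall x, x \in t -> [/\ U x, D x & F x = y]]) ->
  (k * e <= d)%N /\ (F p ^+ 2 != 1 -> (2 * k * e <= d)%N).
Proof.
move=> Dp he; have [m md hm] := lift_degree.
have [chp hp0 ghp] := lift Dp.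
split=> [|F1].
  have [W zW hW] := pow_inj_near k0 hp0.
  have hU : nbhs p (h @^-1` W) by exact: chp.
  have [y [[t [ut <- ht]] /= yB]] := filter_ex (filterI (he _ hU) (near_notin B (F p))).
  have fits z : z \in map h t -> z != 0 /\ gmap k z = y.
    by move=> /mapP[x /ht[_ /lift[_ ? <-] <-] ->].
  have cm z : z \in map h t -> (count (fun x => h x == z) t <= m)%N.
    move=> /fits[z0 gz]; rewrite -size_filter; apply: (hm z); rewrite ?gz ?filter_uniq //.
    by move=> x; rewrite mem_filter => /andP[/eqP ? /ht[]].
  suff : (size t <= 2 * m)%N.
    move=> tm; apply: leq_trans md; rewrite -mulnA mulnCA leq_mul2l.
    by rewrite tm orbT.
  case tE : t ht fits cm => [//|x0 t0] ht fits cm; rewrite -tE in ht fits cm *.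
  have x0t : x0 \in t by rewrite tE mem_head.
  have [/hasP[x1 x1t x10]|/hasPn all0] := boolP (has (fun x => h x != h x0) t).
    (* If [h x] is not [h x0], then [h x ^+ k] is the inverse of [h x0 ^+ k], and injectivity of the
       power on [W] leaves only one such value, namely [h x1]. *)
    have two x : x \in t -> (h x == h x0) || (h x == h x1).
      move=> xt; have hxt := map_f h xt.
      have [z0 gz] := fits _ (map_f h x0t); have [z1 gz1] := fits _ (map_f h x1t).
      have [zx gzx] := fits _ hxt.
      have [Wx _ _] := ht x xt; have [W0 _ _] := ht x0 x0t; have [W1 _ _] := ht x1 x1t.
      have [e0|e0] := gmap_eq zx z0 (etrans gzx (esym gz)).
        by rewrite (hW _ _ Wx W0 e0) eqxx.
      have [e1|e1] := gmap_eq z1 z0 (etrans gz1 (esym gz)).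
        by rewrite (hW _ _ W1 W0 e1) eqxx in x10.
      apply/orP; right; apply/eqP/hW => //.
      by apply: (mulIf (expf_neq0 k z0)); rewrite e0 e1.
    rewrite mul2n -addnn.
    apply: leq_trans (leq_add (cm _ (map_f h x0t)) (cm _ (map_f h x1t))).
    rewrite -count_predUI; apply: leq_trans (leq_addr _ _).
    have /allP : {in t, forall x, (h x == h x0) || (h x == h x1)} by [].
    by rewrite all_count => /eqP <-.
  have /allP : {in t, forall x, h x == h x0} by move=> x /all0; rewrite negbK.
  rewrite all_count => /eqP <-; apply: leq_trans (cm _ (map_f h x0t)) _.
  by rewrite mul2n -addnn leq_addr.
have g1 : gmap k (h p) ^+ 2 != 1 by rewrite ghp.
have [W zW hW] := gmap_inj_near k0 hp0 g1.
have hU : nbhs p (h @^-1` W) by exact: chp.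
have [y [[t [ut <- ht]] /= yB]] := filter_ex (filterI (he _ hU) (near_notin B (F p))).
apply: leq_trans md; rewrite leq_mul2l; apply/orP; right.
case tE : t ht ut => [//|x0 t0] ht ut; rewrite -tE in ht ut *.
have x0t : x0 \in t by rewrite tE mem_head.
have [W0 D0 F0] := ht x0 x0t; have [_ h0 gh0] := lift D0.
apply: (hm (h x0)) => //; first by rewrite gh0 F0.
move=> x xt; have [Wx Dx Fx] := ht x xt; split=> //.
have [_ _ ghx] := lift Dx.
by apply: hW => //; rewrite ghx gh0 Fx F0.
Qed.
End Fibres.
End Counting.

(** * Stereographic charts *)

Section Sphere.
Variable R : realType.
Local Notation C := (Cplane R).
Local Notation S := (S2 R).

Definition coord (i : 'I_3) (v : S) : R := set_val v 0 i.
Definition cx := coord ord0.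
Definition cy := coord (lift ord0 ord0).
Definition cz := coord (lift ord0 (lift ord0 ord0)).

Lemma coord_cont i (v : S) : {for v, continuous (coord i)}.
Proof.
apply: (@cts_comp _ _ _ (set_val : S -> 'rV[R]_3) (fun M => M 0 i)).
  exact: initial_continuous.
exact: coord_continuous.
Qed.

Lemma sphereE (v : 'rV[R]_3) : sphere R v =
  (v 0 ord0 ^+ 2 + v 0 (lift ord0 ord0) ^+ 2 + v 0 (lift ord0 (lift ord0 ord0)) ^+ 2 = 1).
Proof. by rewrite /sphere /= !big_ord_recl big_ord0 addr0 addrA. Qed.

Lemma sphere_eq (v : S) : cx v ^+ 2 + cy v ^+ 2 + cz v ^+ 2 = 1.
Proof. by have := set_valP v; rewrite sphereE. Qed.

Lemma sphere_ext (v w : S) : cx v = cx w -> cy v = cy w -> cz v = cz w -> v = w.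
Proof.
move=> h0 h1 h2; apply: val_inj; apply/rowP => i.
case: (unliftP ord0 i) => [j ->|-> //].
case: (unliftP ord0 j) => [l ->|-> //].
by case: (unliftP ord0 l) => [[]|-> //].
Qed.

Lemma to_sphere (Y : topologicalType) (f0 f1 f2 : Y -> R) :
  (forall y, f0 y ^+ 2 + f1 y ^+ 2 + f2 y ^+ 2 = 1) ->
  exists f : Y -> S, [/\ forall y, cx (f y) = f0 y, forall y, cy (f y) = f1 y,
    forall y, cz (f y) = f2 y &
    forall y, {for y, continuous f0} -> {for y, continuous f1} ->
      {for y, continuous f2} -> {for y, continuous f}].
Proof.
move=> f1E; pose r y : 'rV[R]_3 := \row_i [:: f0 y; f1 y; f2 y]`_i.
have hr y : r y \in sphere R by apply/mem_set; rewrite sphereE !mxE f1E.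
exists (fun y => exist _ (r y) (hr y)).
split; rewrite ?/cx ?/cy ?/cz /coord => //.
- by move=> y; rewrite set_valE /= mxE.
- by move=> y; rewrite set_valE /= mxE.
- by move=> y; rewrite set_valE /= mxE.
- move=> y c0 c1 c2.
  have cr : {for y, continuous r}.
    move=> A [/= P hP hA].
    have h (i : 'I_3) : \forall y' \near y, P 0 i (r y' 0 i).
      have cri : {for y, continuous (fun y => r y 0 i)}.
        have e : (fun y => r y 0 i) = (fun y => [:: f0 y; f1 y; f2 y]`_i).
          by apply/funext => y'; rewrite mxE.
        rewrite e; case: i e => [[|[|[|]]]] //=.
      exact: (near_pull cri (hP 0 i)).
    have := @near_all_seq _ _ (nbhs y) (nbhs_filter y) (enum 'I_3) (fun i y' => P 0 i (r y' 0 i)) (fun i _ => h i).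
    apply: filterS => y' hy'; apply: hA => i j; rewrite ord1.
    by apply: hy'; rewrite mem_enum.
  move=> A [/= _ [[W oW <-] /= Wy] WA].
  have hW : nbhs (r y) W by apply: open_nbhs_nbhs.
  have := near_pull cr hW; apply: filterS => y' Wy'; exact: WA.
Qed.

Lemma S2_hausdorff : hausdorff_space S.
Proof.
move=> v w cl.
have e i : coord i v = coord i w.
  apply: (@norm_hausdorff R R^o) => A B /(@coord_cont i v) hA /(@coord_cont i w) hB.
  by have [x [Ax Bx]] := cl _ _ hA hB; exists (coord i x).
by apply: sphere_ext; exact: e.
Qed.

Definition normsq (z : C) : R := re z ^+ 2 + im z ^+ 2.

(** A homeomorphism from the complement of [q] onto the plane, with [s q] arbitrary. The last clause
    says that [s] tends to infinity at [q]. *)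
Definition chart_off (q : S) (s : S -> C) (s' : C -> S) : Prop :=
  [/\ forall x, x != q -> {for x, continuous s} /\ s' (s x) = x,
      forall z, s' z != q /\ s (s' z) = z,
      continuous s' &
      forall M : R, \forall x \near q, x != q -> M < normsq (s x)].

Lemma stereo_north (q : S) : cx q = 0 -> cy q = 0 -> cz q = 1 ->
  exists s s', chart_off q s s'.
Proof.
move=> q0 q1 q2.
have lt1 (v : S) : v != q -> 0 < 1 - cz v.
  move=> vq; rewrite subr_gt0 lt_neqAle; apply/andP; split; last first.
    apply: contraTT isT; rewrite -ltNge => h; have := sphere_eq v.
    by have := sqr_ge0 (cx v); have := sqr_ge0 (cy v); nra.
  apply: contra_neq vq => v1; have := sphere_eq v; rewrite v1 => e.
  have e2 : cx v ^+ 2 + cy v ^+ 2 = 0 by lra.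
  have /andP[/eqP h0 /eqP h1] : (cx v ^+ 2 == 0) && (cy v ^+ 2 == 0).
    by rewrite -paddr_eq0 ?sqr_ge0 // e2.
  apply: sphere_ext; rewrite ?q0 ?q1 ?q2 //; apply/eqP.
    by rewrite -sqrf_eq0 h0.
  by rewrite -sqrf_eq0 h1.
pose s (v : S) : C := mk (cx v / (1 - cz v)) (cy v / (1 - cz v)).
have np (z : C) : 0 < normsq z + 1 by rewrite ltr_wpDl // addr_ge0 // sqr_ge0.
have [|s' [h0 h1 h2 cs']] := @to_sphere C
  (fun z => 2 * re z / (normsq z + 1)) (fun z => 2 * im z / (normsq z + 1))
  (fun z => (normsq z - 1) / (normsq z + 1)).
  by move=> z; have := lt0r_neq0 (np z); rewrite /normsq => h; field.
exists s, s'; split.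
- move=> v vq; have v1 := lt1 v vq; have v1' := lt0r_neq0 v1; split.
    have cV : {for v, continuous (fun v => (1 - cz v)^-1)}.
      by apply: ctsV; [exact: v1' | apply: ctsB; [exact: cts_cst | exact: coord_cont]].
    by apply: cts_mk; apply: ctsM; do ?[exact: coord_cont | exact: cV].
  have e : normsq (s v) + 1 = 2 / (1 - cz v).
    apply: (mulIf (expf_neq0 2 v1')).
    have -> : (normsq (s v) + 1) * (1 - cz v) ^+ 2 = cx v ^+ 2 + cy v ^+ 2 + (1 - cz v) ^+ 2.
      by rewrite /normsq /s re_mk im_mk; field.
    have -> : cx v ^+ 2 + cy v ^+ 2 = 1 - cz v ^+ 2 by have := sphere_eq v; lra.
    by field.
  have e' : normsq (s v) = 2 / (1 - cz v) - 1 by rewrite -e addrK.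
  apply: sphere_ext; rewrite ?h0 ?h1 ?h2 e ?e' /s ?re_mk ?im_mk; field => //.
- move=> z; have nz := lt0r_neq0 (np z).
  have e : 1 - cz (s' z) = 2 / (normsq z + 1) by rewrite h2; field.
  split.
    apply/eqP => /(congr1 cz); rewrite q2 => h; move: e; rewrite h subrr => /esym/eqP.
    by rewrite mulf_eq0 invr_eq0 (negbTE nz) pnatr_eq0.
  by apply: ceqP; rewrite /s !cE e ?h0 ?h1; field.
- move=> z; have nz := lt0r_neq0 (np z).
  have cn : {for z, continuous normsq}.
    by apply: ctsD; apply: ctsX; [exact: re_cont | exact: im_cont].
  have cV : {for z, continuous (fun z => (normsq z + 1)^-1)}.
    by apply: ctsV; [exact: nz | apply: ctsD; [exact: cn | exact: cts_cst]].
  apply: cs'; (apply: ctsM; last exact: cV).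
  + by apply: ctsM; [exact: cts_cst | exact: re_cont].
  + by apply: ctsM; [exact: cts_cst | exact: im_cont].
  + by apply: ctsB; [exact: cn | exact: cts_cst].
- move=> M.
  (* The bound [M < (1 + cz v) / (1 - cz v)] with its denominator cleared: the difference of the two
     sides is continuous and equals 2 at [q]. *)
  have cM : {for q, continuous (fun v => 1 + cz v - M * (1 - cz v))}.
    apply: ctsB; first by apply: ctsD; [exact: cts_cst | exact: coord_cont].
    by apply: ctsM; [exact: cts_cst | apply: ctsB; [exact: cts_cst | exact: coord_cont]].
  have h := @cvgr_gt _ _ _ _ _ _ cM 0.
  have {}h : \forall v \near q, 0 < 1 + cz v - M * (1 - cz v).
    by apply: h; rewrite q2 subrr mulr0 subr0.
  apply: filterS h => v hv vq; have v1 := lt1 v vq; have v1' := lt0r_neq0 v1.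
  have -> : normsq (s v) = (1 + cz v) / (1 - cz v).
    apply: (mulIf (expf_neq0 2 v1')).
    have -> : normsq (s v) * (1 - cz v) ^+ 2 = cx v ^+ 2 + cy v ^+ 2.
      by rewrite /normsq /s re_mk im_mk; field.
    have -> : cx v ^+ 2 + cy v ^+ 2 = 1 - cz v ^+ 2 by have := sphere_eq v; lra.
    by field.
  by rewrite ltr_pdivlMr //; lra.
Qed.

(* The Householder reflection exchanging q and the north pole (the identity if
   they coincide, since then u = 0 and c = 2 / 0 = 0). *)
Lemma stereo (q : S) : exists s s', chart_off q s s'.
Proof.
pose u0 := cx q; pose u1 := cy q; pose u2 := cz q - 1.
pose uu := u0 ^+ 2 + u1 ^+ 2 + u2 ^+ 2.
pose c := 2 / uu.
(* This identity makes the reflection preserve the sphere and be an involution; stated in this form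
   it covers [uu = 0] too. *)
have cuu : c ^+ 2 * uu = c *+ 2.
  have [u0'|u0'] := eqVneq uu 0; first by rewrite /c u0' invr0 !mulr0 mul0rn.
  by rewrite expr2 -mulrA {2}/c mulfVK // mulr_natr.
pose du v := cx v * u0 + cy v * u1 + cz v * u2.
have [|rho [r0 r1 r2 crho]] := @to_sphere S
  (fun v => cx v - c * du v * u0) (fun v => cy v - c * du v * u1)
  (fun v => cz v - c * du v * u2).
  move=> v; rewrite -(sphere_eq v).
  suff : (c ^+ 2 * uu) * du v ^+ 2 = (c *+ 2) * du v ^+ 2.
    by rewrite /uu /du => h; lra.
  by rewrite cuu.
have cd v : {for v, continuous du}.
  by apply: ctsD; [apply: ctsD|]; (apply: ctsM; [exact: coord_cont | exact: cts_cst]).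
have {}crho : continuous rho.
  by move=> v; apply: crho; (apply: ctsB; first exact: coord_cont);
    (apply: ctsM; last exact: cts_cst); (apply: ctsM; [exact: cts_cst | exact: cd]).
have dr v : du (rho v) = du v - (c * uu) * du v.
  by rewrite {1}/du r0 r1 r2 /uu /du; ring.
have rK v : rho (rho v) = v.
  have e (t : R) : c * (du v - (c * uu) * du v) * t = - (c * du v * t).
    transitivity (c * du v * t - (c ^+ 2 * uu) * du v * t); first by ring.
    by rewrite cuu; ring.
  apply: sphere_ext; rewrite ?r0 ?r1 ?r2 dr ?r0 ?r1 ?r2 e opprK subrK //.
have q1 := sphere_eq q.
have uuE : uu = 2 - 2 * cz q by rewrite /uu /u0 /u1 /u2; lra.
have duq : du q = 1 - cz q by rewrite /du /u0 /u1 /u2; lra.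
have rq : [/\ cx (rho q) = 0, cy (rho q) = 0 & cz (rho q) = 1].
  rewrite r0 r1 r2 duq; have [qz|qz] := eqVneq (cz q) 1.
    have e2 : cx q ^+ 2 + cy q ^+ 2 = 0 by move: q1; rewrite qz; lra.
    have /andP[h0 h1] : (cx q ^+ 2 == 0) && (cy q ^+ 2 == 0).
      by rewrite -paddr_eq0 ?sqr_ge0 // e2.
    rewrite !sqrf_eq0 in h0 h1.
    by rewrite /u0 /u1 /u2 qz (eqP h0) (eqP h1) !subrr !mulr0 ?mul0r !subr0.
  have qz' : 1 - cz q != 0 by rewrite subr_eq0 eq_sym.
  have -> : c * (1 - cz q) = 1.
    by rewrite /c uuE; field; apply: contra_neq qz' => h; lra.
  by rewrite !mul1r /u0 /u1 /u2 !subrr; split => //; ring.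
case: rq => rq0 rq1 rq2.
have [s [s' [hs hs' cs' pole]]] := stereo_north rq0 rq1 rq2.
have rneq v : v != q -> rho v != rho q.
  by apply: contra_neq => e; rewrite -(rK v) e rK.
exists (fun v => s (rho v)), (fun z => rho (s' z)); split.
- move=> v /rneq/hs[cs sK]; split; first exact: (cts_comp (crho v) cs).
  by rewrite sK rK.
- move=> z; have [zq zK] := hs' z; split; last by rewrite rK.
  by apply: contra_neq zq => <-; rewrite rK.
- move=> z; exact: (cts_comp (cs' z) (crho (s' z))).
- move=> M; apply: filterS (near_pull (crho q) (pole M)) => v h /rneq.
  exact: h.
Qed.
End Sphere.

(** * Local degrees *)

Section LocalDegree.
Variables (R : realType) (X Y : topologicalType) (f : X -> Y).
Local Notation C := (Cplane R).

Lemma homeo_cont (Z : topologicalType) (U : set Z) (phi : Z -> C) x : open U -> homeo_to_plane U phi ->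
  U x -> {for x, continuous phi}.
Proof.
move=> oU [+ _] Ux; rewrite continuous_open_subspace // => /(_ x).
by apply; exact/mem_set.
Qed.

Lemma local_degree_cont p k : local_degree R f p k -> {for p, continuous f}.
Proof.
move=> [_ [U [V [phi [psi [[oU Up] [oV Vp] [hphi phip] [hpsi psip] E]]]]]].
have [_ [psi' [cpsi' _ _ psiK]]] := hpsi.
have cphi := homeo_cont oU hphi Up.
apply: (@cts_near _ _ (fun x => psi' (phi x ^+ k))).
  have : nbhs p U by exact: open_nbhs_nbhs.
  by apply: filterS => x /E[Vx <-]; exact: psiK.
apply: (@cts_comp _ _ _ (fun x => phi x ^+ k) psi'); last exact: cpsi'.
by apply: ctsX; exact: cphi.
Qed.

(** In local coordinates the preimages are the [e] roots of [w ^+ e = psi y]; the bound [d ^+ e] on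
    [psi y] keeps them in the disc of radius [d], which [phi'] maps into [U0]. *)
Lemma local_degree_preimages p e (U0 : set X) : local_degree R f p e -> nbhs p U0 ->
  \forall y \near (f p)^', exists t : seq X,
    [/\ uniq t, size t = e & forall x, x \in t -> U0 x /\ f x = y].
Proof.
move=> [e0 [U [V [phi [psi [[oU Up] [oV Vp] [hphi phip] [hpsi psip] E]]]]]] pU0.
have [_ [phi' [cphi' Uphi' phi'K phiK]]] := hphi.
have [_ [psi' [_ _ _ psiK]]] := hpsi.
have cpsi := homeo_cont oV hpsi Vp.
have : \forall w \near (0 : C), U0 (phi' w).
  by apply: (near_pull (cphi' 0)); rewrite -phip phiK.
move=> /nbhs_ballP[/= d d0 hd].
have de0 : 0 < d ^+ e by rewrite exprn_gt0.
have near1 : \forall y \near f p, `|psi y| < d ^+ e.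
  apply: (near_pull (P := fun v : C => `|v| < d ^+ e) cpsi); rewrite psip.
  apply: filterS (nbhsx_ballx (0 : C) _ de0) => v.
  by rewrite /ball /= sub0r normrN.
have near2 : nbhs (f p) V by exact: open_nbhs_nbhs.
apply: dnbhs_near; apply: filterS2 near1 near2 => y yd Vy yp.
have psi0 : psi y != 0.
  by apply: contra_neq yp => y0; rewrite -(psiK y Vy) y0 -psip psiK.
have [s [us ss hs]] := nth_roots e0 psi0.
exists (map phi' s); split; rewrite ?size_map //.
  by rewrite map_inj_uniq //; exact: (can_inj phi'K).
move=> _ /mapP[w ws ->]; have we : w ^+ e = psi y by apply/eqP; rewrite -hs.
split.
  apply: hd; rewrite /ball /= sub0r normrN.
  by rewrite -(ltr_pXn2r e0) ?nnegrE ?normr_ge0 ?(ltW d0) // -normrX we.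
have [Vf psif] := E _ (Uphi' w).
by rewrite -(psiK _ Vf) psif phi'K we psiK.
Qed.

(** Since k divides e, the local model factors through the k-th power, and by [root_punctured] a
    nonvanishing function of [w ^+ k] has a k-th root around the puncture. *)
Lemma local_degree_root p e k (tau : Y -> C) : (0 < k)%N -> (k %| e)%N ->
  local_degree R f p e ->
  (\forall y \near (f p)^', {for y, continuous tau} /\ tau y != 0) ->
  exists r : X -> C, \forall x \near p^', {for x, continuous r} /\ r x ^+ k = tau (f x).
Proof.
move=> k0 ke [e0 [U [V [phi [psi [[oU Up] [oV Vp] [hphi phip] [hpsi psip] E]]]]]] htau.
have [_ [phi' [cphi' Uphi' phi'K phiK]]] := hphi.
have [_ [psi' [cpsi' Vpsi' psi'K psiK]]] := hpsi.
have psi'0 : psi' 0 = f p by rewrite -psip psiK.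
have htheta : \forall w \near (0 : C)^', {for w, continuous (fun w => tau (psi' w))} /\
    tau (psi' w) != 0.
  have inj0 (w : C) : psi' w = psi' 0 -> w = 0 by move=> h; rewrite -(psi'K w) h psi'K.
  have := htau; rewrite -psi'0 => /(near_pull_dnbhs (cpsi' 0) inj0).
  by apply: filterS => w [ct tn0]; split=> //; exact: (cts_comp (cpsi' w) ct).
have [rho crho rhok] := root_punctured k0 htheta.
pose e' := (e %/ k)%N.
have ee : e = (e' * k)%N by rewrite /e' divnK.
have e'0 : (0 < e')%N by rewrite divn_gt0 // dvdn_leq.
have cphiX x : U x -> {for x, continuous (fun x => phi x ^+ e')}.
  by move=> Ux; apply: ctsX; exact: (homeo_cont oU hphi Ux).
exists (fun x => rho (phi x ^+ e')).
have near1 : nbhs p U by exact: open_nbhs_nbhs.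
have near2 : \forall x \near p, phi x ^+ e' != 0 ->
    rho (phi x ^+ e') ^+ k = tau (psi' ((phi x ^+ e') ^+ k)).
  have h0 : phi p ^+ e' = 0 by rewrite phip expr0n gtn_eqF.
  apply: (near_pull (P := fun w : C => w != 0 -> rho w ^+ k = tau (psi' (w ^+ k))) (cphiX p Up)).
  by rewrite h0; exact: near_dnbhs rhok.
apply: dnbhs_near; apply: filterS2 near1 near2 => x Ux hx xp.
have nz : phi x ^+ e' != 0.
  rewrite expf_neq0 //; apply: contra_neq xp => x0.
  by rewrite -(phiK x Ux) x0 -phip phiK.
split; first exact: (cts_comp (cphiX x Ux) (crho _ nz)).
have [Vx psix] := E x Ux.
by rewrite hx // -exprM -ee -psix psiK.
Qed.
End LocalDegree.

(** * A coordinate placing three given points at infinity, 1 and -1 *)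

Section Normalization.
Variable R : realType.
Local Notation C := (Cplane R).
Local Notation S := (S2 R).

Lemma normsqM (z w : C) : normsq (z * w) = normsq z * normsq w.
Proof. by rewrite /normsq !cE; ring. Qed.

Lemma normsq_ge0 (z : C) : 0 <= normsq z.
Proof. by rewrite addr_ge0 ?sqr_ge0. Qed.

Lemma normsq_gt1 (z : C) : 1 < normsq z -> z != 0 /\ 0 < re (1 - z ^- 2).
Proof.
move=> z1; have z0 : z != 0.
  by apply: contraTneq z1 => ->; rewrite /normsq !cE expr0n addr0 ltr10.
split=> //; have n0 : normsq z != 0 by rewrite lt0r_neq0 // (lt_trans _ z1).
have -> : z ^- 2 = mk ((re z ^+ 2 - im z ^+ 2) / normsq z ^+ 2) (- (2 * re z * im z / normsq z ^+ 2)).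
  apply: (mulIf (expf_neq0 2 z0)); rewrite mulVf ?expf_neq0 //.
  by apply: ceqP; rewrite /normsq expr2 !cE; rewrite /normsq in n0; field.
rewrite !cE subr_gt0 ltr_pdivrMr ?exprn_gt0 // ?(lt_trans _ z1) // mul1r.
apply: (@le_lt_trans _ _ (normsq z)).
  by rewrite /normsq lerD2l -subr_ge0 opprK addr_ge0 // sqr_ge0.
by rewrite expr2 ltr_pMr // (lt_trans _ z1).
Qed.

(** The last clause is the form in which the pole at [y0] is used: it allows a principal square root
    of [1 - t ^- 2]. *)
Definition normalized (y0 y1 y2 : S) (t : S -> C) (t' : C -> S) : Prop :=
  [/\ forall y, y != y0 -> {for y, continuous t} /\ t' (t y) = y,
      forall z, t' z != y0 /\ t (t' z) = z,
      continuous t',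
      t y1 = 1 /\ t y2 = -1 &
      \forall y \near y0^', t y != 0 /\ 0 < re (1 - t y ^- 2)].

Lemma normalized_chart (y0 y1 y2 : S) : y0 != y1 -> y0 != y2 -> y1 != y2 ->
  exists t t', normalized y0 y1 y2 t t'.
Proof.
move=> y01 y02 y12; have [s [s' [hs hs' cs' pole]]] := stereo y0.
have [|_ s1] := hs y1; first by rewrite eq_sym.
have [|_ s2] := hs y2; first by rewrite eq_sym.
pose a := s y1; pose b := s y2.
have ab : a - b != 0 by rewrite subr_eq0; apply: contra_neq y12 => e; rewrite -s1 -s2 -/a e.
have t2 : (2 : C) != 0 by rewrite pnatr_eq0.
pose t y := (2 * s y - (a + b)) / (a - b).
pose u (z : C) := ((a - b) * z + (a + b)) / 2.
have tu z : s (s' (u z)) = u z by have [_] := hs' (u z).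
have uK z : (2 * u z - (a + b)) / (a - b) = z by rewrite /u; field; rewrite ab.
exists t, (fun z => s' (u z)); split.
- move=> y yy0; have [cs sK] := hs y yy0; split.
    apply: ctsM; last exact: cts_cst.
    by apply: ctsB; [apply: ctsM; [exact: cts_cst | exact: cs] | exact: cts_cst].
  have -> : u (t y) = s y by rewrite /u /t; field; rewrite ab.
  exact: sK.
- by move=> z; have [zy0 _] := hs' (u z); split=> //; rewrite /t tu uK.
- move=> z; have cu : {for z, continuous u}.
    apply: ctsM; last exact: cts_cst.
    apply: ctsD; last exact: cts_cst.
    by apply: ctsM; [exact: cts_cst | exact: cts_id].
  exact: (cts_comp cu (cs' (u z))).
- by split; rewrite /t -/a -/b; field; rewrite ab.
(* With N = [normsq], the parallelogram law gives 4 N(s) <= 2 N(2s - (a + b)) + 2 N(a + b). The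
   chosen bound on N(s) thus forces N(2s - (a + b)) > N(a - b), that is N(t) > 1. *)
- apply: dnbhs_near; apply: filterS (pole (normsq (a + b) + normsq (a - b))) => y + yy0.
  move=> /(_ yy0) big; apply: normsq_gt1.
  have nab : 0 < normsq (a - b).
    rewrite lt0r normsq_ge0 andbT; apply: contra_neq ab => e.
    have : (re (a - b) ^+ 2 == 0) && (im (a - b) ^+ 2 == 0).
      by rewrite -paddr_eq0 ?sqr_ge0 //; apply/eqP.
    by rewrite !sqrf_eq0 => /andP[/eqP ? /eqP ?]; apply: ceqP.
  have := normsqM (t y) (a - b); rewrite /t mulfVK // -/(t y) => e.
  rewrite -(ltr_pM2r nab) mul1r -e.
  have par (z w : C) : normsq (z + w) <= 2 * normsq z + 2 * normsq w.
    rewrite -subr_ge0; have -> : 2 * normsq z + 2 * normsq w - normsq (z + w) = normsq (z - w).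
      by rewrite /normsq !cE; ring.
    exact: normsq_ge0.
  have := par (2 * s y - (a + b)) (a + b); rewrite subrK normsqM.
  have -> : normsq (2 : C) = 4.
    transitivity (normsq (1 + 1 : C)); first by [].
    by rewrite /normsq !cE; ring.
  have := normsq_ge0 (a + b); lra.
Qed.

End Normalization.

(** * The lift on the sphere *)

Section Planar.
Variables (R : realType) (k : nat) (f : S2 R -> S2 R).
Local Notation C := (Cplane R).
Local Notation S := (S2 R).

(* q plays the role of a point over y0, which is removed from the source. *)
Lemma sphere_lift (y0 y1 y2 q : S) (t : S -> C) (t' : C -> S) (L0 L12 : seq S) :
  (0 < k)%N -> normalized y0 y1 y2 t t' -> y0 != y1 -> y0 != y2 -> y1 != y2 ->
  continuous f -> f q = y0 ->
  (forall x, (x \in L0) = (f x == y0)) ->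
  (forall x, (x \in L12) = (f x == y1) || (f x == y2)) ->
  (forall x, x \in L0 -> exists2 e, local_degree R f x e & (k %| e)%N) ->
  (forall x, x \in L12 -> exists2 e, local_degree R f x e & (2 %| e)%N) ->
  exists h : S -> C, forall x, f x != y0 ->
    [/\ {for x, continuous h}, h x != 0 & gmap k (h x) = t (f x)].
Proof.
move=> k0 [ht ht' ct' [t1 t2] tpole] y01 y02 y12 cf fq mL0 mL12 deg0 deg12.
have [s [s' [hs hs' cs' _]]] := stereo q.
have s'inj (z w : C) : s' w = s' z -> w = z.
  by move=> e; have [_ <-] := hs' w; have [_ <-] := hs' z; rewrite e.
pose F z := t (f (s' z)).
pose P := [seq s x | x <- L0 & x != q].
have mP z : (z \in P) = (f (s' z) == y0).
  have [zq sK] := hs' z; apply/mapP/eqP => [[x]|fz].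
    rewrite mem_filter mL0 => /andP[xq /eqP fx] ->; have [_ ->] := hs x xq; exact: fx.
  by exists (s' z); rewrite ?sK // mem_filter zq mL0 fz eqxx.
pose Q := [seq s x | x <- L12].
have tinj y z : y != y0 -> z != y0 -> t y = t z -> y = z.
  by move=> /ht[_ yK] /ht[_ zK] e; rewrite -yK -zK e.
have y10 : y1 != y0 by rewrite eq_sym.
have y20 : y2 != y0 by rewrite eq_sym.
have F1 z : z \notin P -> F z ^+ 2 = 1 -> s' z \in L12.
  rewrite mP mL12 => fz /eqP; rewrite sqrf_eq1 => /orP[/eqP|/eqP] e.
    by rewrite (tinj _ _ fz y10 (etrans e (esym t1))) eqxx.
  by rewrite (tinj _ _ fz y20 (etrans e (esym t2))) eqxx orbT.
have root_at (tau : S -> C) (j : nat) (z : C) e : (0 < j)%N -> (j %| e)%N ->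
    local_degree R f (s' z) e ->
    (\forall y \near (f (s' z))^', {for y, continuous tau} /\ tau y != 0) ->
    exists r : C -> C, \forall w \near z^', {for w, continuous r} /\ r w ^+ j = tau (f (s' w)).
  move=> j0 je le htau; have [r hr] := local_degree_root j0 je le htau.
  exists (fun w => r (s' w)).
  have := near_pull_dnbhs (cs' z) (s'inj z) hr.
  by apply: filterS => w [cr rj]; split=> //; exact: (cts_comp (cs' w) cr).
have cfs z : {for z, continuous (fun z => f (s' z))} by exact: (cts_comp (cs' z) (cf _)).
have [|||||h hh] := @dihedral_lift R k F P Q k0.
- by move=> z; rewrite mP => fz; exact: (cts_comp (cfs z) (ht _ fz).1).
- move=> z; rewrite mP => /eqP fz; have := near_dnbhs tpole; rewrite -fz => h.
  by apply: filterS2 (near_notin P z) (nbhs_dnbhs (near_pull (cfs z) h)) => w;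
    rewrite mP fz => h1; apply.
- move=> z zP; have x0 : s' z \in L0 by rewrite mL0 -mP.
  have [e le ke] := deg0 _ x0; apply: (root_at t k z e k0 ke le).
  move: zP; rewrite mP => /eqP ->; apply: dnbhs_near.
  by apply: filterS (near_dnbhs tpole) => y hy yy0; split; [exact: (ht y yy0).1 | exact: (hy yy0).1].
- move=> z zP Fz; apply/mapP; exists (s' z); first exact: F1.
  by have [_ ->] := hs' z.
- move=> z zP Fz; have x12 := F1 z zP Fz.
  have [e le te] := deg12 _ x12.
  (* Away from [y0], [t ^+ 2 - 1] vanishes only at [y1] and [y2], so it is nonzero on a punctured
     neighbourhood and the even local degree yields its square root. *)
  apply: (root_at (fun y => t y ^+ 2 - 1) 2 z e isT te le).
  have := near_notin_hausdorff [:: y0; y1; y2] (f (s' z)) (@S2_hausdorff R).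
  apply: filterS => y; rewrite !inE !negb_or => /and3P[yy0 yy1 yy2].
  have [ct _] := ht y yy0; split; first by apply: ctsB; [apply: ctsX; exact: ct | exact: cts_cst].
  rewrite subr_eq0 sqrf_eq1; apply/norP; split.
    by apply: contra_neq yy1 => e1; exact: (tinj _ _ yy0 y10 (etrans e1 (esym t1))).
  by apply: contra_neq yy2 => e1; exact: (tinj _ _ yy0 y20 (etrans e1 (esym t2))).
exists (fun x => h (s x)) => x fx.
have xq : x != q by apply: contra_neq fx => ->.
have [cs sK] := hs x xq.
have [|ch h0 hk] := hh (s x); first by rewrite mP sK.
split; [exact: (cts_comp cs ch) | exact: h0 |].
by apply/gmapE; rewrite hk /F sK.
Qed.
End Planar.

(** * From the branch datum to the bounds *)

Lemma card_eq_seq (T : eqType) (A : set T) (d : nat) : (A #= `I_d)%card ->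
  exists t : seq T, [/\ uniq t, size t = d & forall x, x \in t <-> A x].
Proof.
move=> Ad; have [g [gA ginj gsurj]] := elimT card_set_bijP Ad.
have /finite_seqP[s As] : finite_set A by exists d.
have mA z : z \in undup s <-> A z by rewrite mem_undup As.
exists (undup s); split=> //; first exact: undup_uniq.
have -> : size (undup s) = size (map g (undup s)) by rewrite size_map.
rewrite -[RHS](size_iota 0); apply/perm_size/uniq_perm; last 1 first.
- move=> i; rewrite mem_iota /= add0n; apply/mapP/idP => [[z /mA/gA iz ->] //|id].
  by have [z Az <-] := gsurj i id; exists z => //; apply/mA.
- rewrite map_inj_in_uniq ?undup_uniq // => y z /mA Ay /mA Az.
  by apply: ginj; exact/mem_set.
- exact: iota_uniq.
Qed.

Theorem corollary1p6 (R : realType) (n d k : nat) (part : 'I_n -> seq nat)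
  (hn : (3 <= n)%N)
  (hdatum : branch_datum d part)
  (hk : (1 < k)%N) (hkd : (2 * k < d)%N)
  (hdvd : (2 * k %| d)%N)
  (h1 : forall i : 'I_n, nat_of_ord i = 0%N ->
     forall e : nat, e \in part i -> (k %| e)%N)
  (h23 : forall i : 'I_n, nat_of_ord i = 1%N \/ nat_of_ord i = 2%N ->
     forall e : nat, e \in part i -> (2 %| e)%N)
  (hreal : realizable R (S2 R) (S2 R) d part) :
  (forall i : 'I_n, nat_of_ord i = 1%N \/ nat_of_ord i = 2%N ->
     forall e : nat, e \in part i -> (e <= d %/ k)%N) /\
  (forall i : 'I_n, (3 <= i)%N ->
     forall e : nat, e \in part i -> (e <= d %/ (2 * k))%N).
Proof.
have k0 : (0 < k)%N by rewrite ltnW.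
have [d2 hpart] := hdatum.
have [f [x [bc cd xinj branch hp]]] := hreal.
(* Indices start at 0, so [i0], [i1], [i2] stand for the first three partitions. *)
pose i0 : 'I_n := Ordinal (ltn_trans (isT : (0 < 2)%N) hn).
pose i1 : 'I_n := Ordinal (ltn_trans (isT : (1 < 2)%N) hn).
pose i2 : 'I_n := Ordinal hn.
have y01 : x i0 != x i1 by rewrite (inj_eq xinj).
have y02 : x i0 != x i2 by rewrite (inj_eq xinj).
have y12 : x i1 != x i2 by rewrite (inj_eq xinj).
have cf : continuous f by move=> p; have [e /local_degree_cont] := bc p.
have /choice[L hL] (i : 'I_n) : exists L : seq (S2 R),
    (forall p, (p \in L) = (f p == x i)) /\
    (forall p, p \in L -> exists2 e, local_degree R f p e & e \in part i) /\
    (forall e, e \in part i -> exists2 p, f p = x i & local_degree R f p e).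
  have [p [pinj fp degp]] := hp i.
  have fpj j : f (p j) = x i.
    have : (f @^-1` [set x i]) (p j) by rewrite fp; exists j.
    by [].
  exists [seq p j | j <- enum 'I_(size (part i))]; split; last split.
  - move=> y; apply/mapP/eqP => [[j _ ->] //|fy].
    have : (f @^-1` [set x i]) y by [].
    by rewrite fp => -[j _ <-]; exists j; rewrite ?mem_enum.
  - move=> _ /mapP[j _ ->]; exists (nth 0%N (part i) j); first exact: degp.
    exact: mem_nth.
  - move=> e /(nthP 0%N)[j js <-]; exists (p (Ordinal js)); first exact: fpj.
    exact: (degp (Ordinal js)).
(* A partition of a positive [d] has at least one part. *)
have [q fq] : exists q, f q = x i0.
  have [_ [_]] := hL i0; have [_] := hpart i0.
  case: (part i0) => [/= d0|e s _]; first by rewrite -d0 in d2.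
  by move=> /(_ e (mem_head _ _))[q]; exists q.
have [t [t' nt]] := normalized_chart y01 y02 y12.
have [h hh] : exists h : S2 R -> Cplane R, forall p, f p != x i0 ->
    [/\ {for p, continuous h}, h p != 0 & gmap k (h p) = t (f p)].
  apply: (@sphere_lift R k f _ _ _ q t t' (L i0) (L i1 ++ L i2) k0 nt y01 y02 y12 cf fq).
  - by have [] := hL i0.
  - by move=> p; rewrite mem_cat; have [-> _] := hL i1; have [-> _] := hL i2.
  - have [_ [deg _]] := hL i0; move=> p /deg[e le ep]; exists e => //.
    exact: (h1 i0).
  - have [_ [deg1 _]] := hL i1; have [_ [deg2 _]] := hL i2.
    move=> p; rewrite mem_cat => /orP[/deg1|/deg2] [e le ep]; exists e => //.
      by apply: (h23 i1) => //; left.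
    by apply: (h23 i2) => //; right.
have [ht ht' ct' [t1 t2] _] := nt.
(* The entry [t (x i0)] is an arbitrary value, as [t] is uncontrolled at [x i0]; it merely enlarges
   a finite exceptional set. *)
pose B := [seq t (x i) | i <- enum 'I_n].
have tB i : t (x i) \in B by apply: map_f; rewrite mem_enum.
have notB y i : y \notin B -> t' y <> x i.
  by move=> yB e; move: yB; have [_ <-] := ht' y; rewrite e tB.
have fibre y p : t' y = f p <-> f p != x i0 /\ t (f p) = y.
  split=> [<-|[fp0 <-]]; first by have [-> ->] := ht' y.
  by have [_ ->] := ht _ fp0.
have fibreF y : y \notin B -> exists s : seq (S2 R),
    [/\ uniq s, size s = d & forall p, p \in s <-> f p != x i0 /\ t (f p) = y].
  move=> yB; have [|s [us ss ms]] := @card_eq_seq _ (f @^-1` [set t' y]) d.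
    by apply: cd => br; have [j] := branch _ br; exact: notB.
  exists s; split=> // p; rewrite ms -fibre.
  by split=> [->|->].
have preim p e (U : set (S2 R)) : f p != x i0 -> local_degree R f p e -> nbhs p U ->
    \forall y \near (t (f p))^', exists s : seq (S2 R), [/\ uniq s, size s = e &
      forall p', p' \in s -> [/\ U p', f p' != x i0 & t (f p') = y]].
  move=> fp0 le pU; have [_ tK] := ht _ fp0.
  have t'inj y : t' y = t' (t (f p)) -> y = t (f p).
    by move=> e1; have [_ <-] := ht' y; rewrite e1 tK.
  have := local_degree_preimages le pU; rewrite -{1}tK.
  move=> /(near_pull_dnbhs (ct' _) t'inj); apply: filterS => y [s [us ss hs]].
  exists s; split=> // p' /hs[Up' fp']; have := (fibre y p').1 (esym fp').
  by move=> [].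
have openF p : f p != x i0 -> t (f p) \notin B -> forall U : set (S2 R), nbhs p U ->
    \forall y \near t (f p), exists p', [/\ U p', f p' != x i0 & t (f p') = y].
  move=> fp0 _ U pU; have [e le] := bc p; have e0 := le.1.
  apply: filterS (near_dnbhs (preim p e U fp0 le pU)) => y.
  have [->|yp] := eqVneq y (t (f p)).
    by move=> _; exists p; split=> //; exact: nbhs_singleton.
  move=> /(_ isT)[[|p' s] [_ se hs]]; first by rewrite -se in e0.
  by exists p'; apply: hs; exact: mem_head.
have ramified (y : Cplane R) : y ^+ 2 = 1 -> y \in B.
  move=> /eqP; rewrite sqrf_eq1 => /orP[/eqP ->|/eqP ->]; first by rewrite -t1.
  by rewrite -t2.
have bound i e : i != i0 -> e \in part i ->
    (k * e <= d)%N /\ (t (x i) ^+ 2 != 1 -> (2 * k * e <= d)%N).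
  move=> ii0 ei; have [_ [_ /(_ e ei)[p fp le]]] := hL i.
  have fp0 : f p != x i0 by rewrite fp (inj_eq xinj).
  rewrite -fp.
  apply: (@local_degree_bound R _ k d (fun p => f p != x i0) (fun p => t (f p)) h B
    k0 (@S2_hausdorff R) ramified fibreF openF hh p e fp0).
  by move=> U pU; exact: preim.
split=> i hi e ei.
  have ii0 : i != i0 by apply/eqP => ie; case: hi; rewrite ie.
  by rewrite leq_divRL // mulnC; have [] := bound i e ii0 ei.
have ii0 : i != i0 by apply/eqP => ie; rewrite ie in hi.
rewrite leq_divRL ?muln_gt0 // mulnC; have [_] := bound i e ii0 ei; apply.
have fi0 : x i != x i0 by rewrite (inj_eq xinj).
(* [t] is injective off [x i0]; applied to [i1] and [i2] this keeps [t (x i)] away from 1 and -1,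
   where the bound would be weaker. *)
have tne j : j != i0 -> i != j -> t (x i) <> t (x j).
  move=> jj0 ij e1; have fj0 : x j != x i0 by rewrite (inj_eq xinj).
  have [_ ti] := ht _ fi0; have [_ tj] := ht _ fj0.
  by move: ij; rewrite -(inj_eq xinj) -ti -tj e1 eqxx.
rewrite sqrf_eq1 -{1}t1 -t2; apply/norP; split; apply/eqP; apply: tne => //.
  by apply/eqP => ie; rewrite ie in hi.
by apply/eqP => ie; rewrite ie in hi.
Qed.
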